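(* Let $N\ge 2$ be an integer, let $\alpha\in\mathbb{R}$ with $0<\alpha\le\sqrt N-1$, and let $m\in\{2,3\}$. Suppose $I_\alpha=\Delta_d\cup\dots\cup\Delta_{d-m}$, where $d=d(\alpha)$ (i.e. $I_\alpha$ consists of exactly $m+1$ cylinder sets). If $T_\alpha(\alpha)\ge f_{d-1}$ or $T_\alpha(\alpha+1)\le f_{d-m+1}$, then $I_\alpha$ is gapless.
   Context: For an integer $N\ge 2$ and a real $\alpha$ with $0<\alpha\le\sqrt N-1$, put $I_\alpha=[\alpha,\alpha+1]$. Define the digit function $d:I_\alpha\to\mathbb{N}$ by $d(x)=\lfloor N/x-\alpha\rfloor$ if $x\in(\alpha,\alpha+1]$, or if $x=\alpha$ and $N/\alpha-\alpha\notin\mathbb{Z}$; and $d(\alpha)=\lfloor N/\alpha-\alpha\rfloor-1$ if $N/\alpha-\alpha\in\mathbb{Z}$. The $N$-expansion map $T_\alpha:I_\alpha\to I_\alpha$ is $T_\alpha(x)=N/x-d(x)$. The cylinder sets are $\Delta_i=\{x\in I_\alpha: d(x)=i\}$, which are non-empty exactly for $d(\alpha+1)\le i\le d(\alpha)$. Writing $I_\alpha=\Delta_d\cup\dots\cup\Delta_{d-m}$ means that $d=d(\alpha)$ and $d-m=d(\alpha+1)$, so there are exactly $m+1$ cylinder sets. The fixed point of $T_\alpha$ in $\Delta_i$ is $f_i=f_i(N)=\frac{\sqrt{4N+i^2}-i}{2}$. A gap of $I_\alpha$ is a (non-empty) open interval $(a,b)\subset I_\alpha$ that is maximal with respect to the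 property: for Lebesgue-almost every $x\in I_\alpha$ there is $n_0\in\mathbb{N}$ such that $T_\alpha^n(x)\notin(a,b)$ for all $n\ge n_0$. $I_\alpha$ is gapless if it has no gaps. *)

(* Defs.v *)
From HB Require Import structures.
From mathcomp Require Import all_boot all_order all_algebra.
From mathcomp Require Import all_classical all_reals all_analysis.

Set Implicit Arguments.
Unset Strict Implicit.
Unset Printing Implicit Defensive.
Import Order.TTheory GRing.Theory Num.Theory.

Local Open Scope classical_set_scope.
Local Open Scope ring_scope.

Section NExpansion.
Context {R : realType}.
Implicit Types (N : nat) (alpha x a b : R) (i : int).

Definition Ialpha alpha : set R := `[alpha, alpha + 1]%classic.

(* [digit] and [Tmap] are total on R, but only their values on [Ialpha alpha]
   are meaningful; when 0 < alpha <= sqrt N - 1, [Tmap] maps [Ialpha alpha]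
   into itself and the digits there are positive, so taking them in [int]
   loses nothing and makes the subtraction of digits untruncated. *)
Definition digit N alpha x : int :=
  if (x == alpha) && (N%:R / alpha - alpha \is a Num.int)
  then Num.floor (N%:R / alpha - alpha) - 1
  else Num.floor (N%:R / x - alpha).

Definition Tmap N alpha x : R := N%:R / x - (digit N alpha x)%:~R.

Definition fixpt N i : R := (Num.sqrt (4 * N%:R + i%:~R ^+ 2) - i%:~R) / 2.

Definition eventually_avoided N alpha (U : set R) : Prop :=
  {ae lebesgue_measure, forall x, Ialpha alpha x ->
    exists n0 : nat, forall n : nat, (n0 <= n)%N ->
      ~ U (iter n (Tmap N alpha) x)}.

Definition avoided_interval N alpha (U : set R) : Prop :=
  (exists a b, a < b /\ U = `]a, b[%classic) /\
  U `<=` Ialpha alpha /\ eventually_avoided N alpha U.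

Definition gap N alpha (U : set R) : Prop :=
  avoided_interval N alpha U /\
  forall V, avoided_interval N alpha V -> U `<=` V -> V = U.

Definition gapless N alpha : Prop := ~ exists U, gap N alpha U.

Definition cylinder N alpha i : set R :=
  [set x | Ialpha alpha x /\ digit N alpha x = i].

(* Encodes "Ialpha is the union of the cylinders of digits d, ..., d - m, with
   d the digit of alpha". On [Ialpha alpha] the digit function is
   non-increasing and takes every integer value between those at the endpoints,
   so [cylinder N alpha i] is non-empty exactly for d - m <= i <= d. *)
Definition cylinder_range N alpha (d : int) (m : nat) : Prop :=
  digit N alpha alpha = d /\ digit N alpha (alpha + 1) = d - m%:Z.

End NExpansion.

(* Main.v *)
Require Import Defs.
From HB Require Import structures.
From mathcomp Require Import all_boot all_order all_algebra.
From mathcomp Require Import all_classical all_reals all_analysis.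
From mathcomp Require Import measurable_realfun.
From mathcomp Require Import ring lra.

Set Implicit Arguments.
Unset Strict Implicit.
Unset Printing Implicit Defensive.
Import Order.TTheory GRing.Theory Num.Theory.

Local Open Scope classical_set_scope.
Local Open Scope ring_scope.

(** Let [beta = alpha + 1] and let [U] be a nonempty open subinterval of
[[alpha, beta]]. No such [U] is avoided by almost every orbit, so there is no
candidate for a gap, let alone a maximal one. Two facts give this.

Every interval of positive length contains a smaller one that some iterate of
[T] maps into [U] ([hits_everywhere]). Call an interval bad when it contains no
such subinterval. Badness passes to subintervals, to unions of overlapping
intervals, and to images under a single branch of [T]; the aim is that one bad
interval of positive length would make [[alpha, beta]] bad, which it is not,
since it contains [U]. Let [f] be the fixed point in the hypothesis, [e] the
digit of its branch and [c = f + e]; then [N = f * c], and [f] and [-c] are the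
fixed points of [x |-> N / x - e]. In the coordinate [h x = x / (x + c)] that
branch is affine and expands by [c / f], while the branch of digit [e - j]
expands [h y - h x] by [f * c / ((f + j * h x) * (f + j * h y))]
([hfun_expansion]). All branches expand, so a bad interval inside one branch has
a longer bad image. A bad interval with a cut point inside breaks into two, whose
images are attached to [alpha] and to [beta]: its length is controlled by the
maximal bad intervals [[alpha, l]] and [[r, beta]]. A bad interval ending at [f]
grows, under the branch of [f], until it covers everything. If [f <= T alpha],
the image of [[alpha, l]] therefore stays to the right of [f]; following it one
or two steps further bounds the lengths of [[alpha, l]] and [[r, beta]] by small
multiples of the supremum of all lengths of bad intervals, small enough to make
that supremum smaller than itself ([three_branch], [four_branch]). The case
[T beta <= f] is the mirror image. That the rates are small enough for three
and for four digits is a matter of polynomial inequalities between [alpha], [f]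
and [e] ([rates_three_left], [rates_three_right], [rates_four_left],
[rates_four_right]).

The points that visit [U] after time [n] have measure at least some positive
constant that does not depend on [n] ([lower_bound]). Inverse branches of the
iterates of [T] are Moebius maps with nonnegative coefficients, hence have
distortion at most [(beta / alpha) ^+ 2], and [T] expands lengths by at least
[(N / (N - alpha)) ^+ 2] every two steps, so pieces of intervals grow faster
than they are cut; long pieces contain a definite proportion of points about to
visit [U]. By continuity of the measure along the decreasing sequence of these
sets, a set of positive measure visits [U] infinitely often ([not_avoided]). *)

(** * Bad intervals and decreasing branches *)

Section BadFamilies.
Context {R : realType}.
Implicit Types (bad : R -> R -> Prop) (h F : R -> R).

(** The properties of the intervals [[x, y]] that contain no open
    subinterval mapped into a given set by an iterate. Empty and one-point
    intervals count as bad; the two closure properties are what makes maximal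
    bad intervals exist. *)
Record bad_family bad : Prop := BadFamily {
  bad0 : forall x y, y <= x -> bad x y;
  badW : forall x y x' y', bad x y -> x <= x' -> y' <= y -> bad x' y';
  badU : forall x y y' z, bad x y -> bad y' z -> y' <= y -> bad x z;
  bad_sup : forall x y, (forall t, t < y -> bad x t) -> bad x y;
  bad_inf : forall x y, (forall t, x < t -> bad t y) -> bad x y }.

(** A branch of an expanding map seen through the coordinate [h]: [k] is
    the contraction rate of its inverse. Its monotonicity is not assumed, as it
    follows from [br_contr] ([br_anti]). *)
Record branch bad h (al be : R) F (lo hi k : R) : Prop := Branch {
  br_range : forall x, lo <= x -> x <= hi -> al <= F x <= be;
  br_contr : forall x y, lo <= x -> x <= y -> y <= hi -> h y - h x <= k * (h (F x) - h (F y));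
  br_bad : forall x y, lo <= x -> x <= y -> y <= hi -> bad x y -> bad (F y) (F x) }.

Lemma sup_contr (S : set R) : S !=set0 -> has_ubound S -> (forall t, S t -> 0 < t) ->
  (forall M, 0 < M -> ubound S M -> exists2 M', M' < M & ubound S M') -> False.
Proof.
move=> S0 Sb Sp H.
have hS : has_sup S by split.
have ub : ubound S (sup S) by apply: sup_upper_bound.
have pos : 0 < sup S by case: S0 => t St; apply: lt_le_trans (Sp _ St) (ub _ St).
have [M' lt ub'] := H _ pos ub.
by have := ge_sup S0 ub'; rewrite leNgt lt.
Qed.

Section Family.
Context (bad : R -> R -> Prop) (bf : bad_family bad).

Lemma extend_right a hi : a <= hi ->
  exists l, [/\ a <= l, l <= hi, bad a l & forall x, a <= x -> x <= hi -> bad a x -> x <= l].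
Proof.
move=> ah; pose S := [set x | [/\ a <= x, x <= hi & bad a x]].
have Sa : S a by split => //; apply: (bad0 bf).
have hS : has_sup S by split; [exists a | exists hi => x [_ ? _]].
have ub := sup_upper_bound hS.
exists (sup S); split.
- exact: ub.
- by apply: ge_sup => [|x [_ ? _]//]; exists a.
- apply: (bad_sup bf) => t tS.
  have e0 : 0 < sup S - t by rewrite subr_gt0.
  have [x [ax xh bx] xt] := sup_adherent e0 hS.
  apply: (badW bf bx) => //; move: xt; rewrite opprB addrCA subrr addr0; exact: ltW.
- by move=> x ax xh bx; apply: ub.
Qed.

Lemma extend_left lo b : lo <= b ->
  exists r, [/\ lo <= r, r <= b, bad r b & forall x, lo <= x -> x <= b -> bad x b -> r <= x].
Proof.
move=> lb; pose S := [set x | [/\ lo <= x, x <= b & bad x b]].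
have Sa : S b by split => //; apply: (bad0 bf).
have hS : has_inf S by split; [exists b | exists lo => x [? _ _]].
have lb' : lbound S (inf S) by apply: ge_inf; case: hS.
exists (inf S); split.
- by apply: lb_le_inf => [|x [? _ _]//]; exists b.
- exact: lb'.
- apply: (bad_inf bf) => t tS.
  have e0 : 0 < t - inf S by rewrite subr_gt0.
  have [x [ax xh bx] xt] := inf_adherent e0 hS.
  by apply: (badW bf bx) => //; move: xt; rewrite addrC subrK; exact: ltW.
- by move=> x ax xh bx; apply: lb'.
Qed.

Context (h : R -> R) (al be : R).
Hypothesis hmono : forall x y, al <= x -> x < y -> y <= be -> h x < h y.

Lemma hle x y : al <= x -> x <= y -> y <= be -> h x <= h y.
Proof. by move=> ax; rewrite le_eqVlt => /predU1P[->//|xy] yb; apply/ltW/hmono. Qed.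

Lemma h_inj_le x y : al <= y -> x <= be -> h x <= h y -> x <= y.
Proof. by move=> ay xb hxy; rewrite leNgt; apply/negP => /(hmono ay)/(_ xb); rewrite ltNge hxy.
  Qed.

Lemma br_anti F lo hi k x y : 0 <= k -> al <= lo -> hi <= be -> branch bad h al be F lo hi k ->
  lo <= x -> x <= y -> y <= hi -> F y <= F x.
Proof.
move=> k0 alo hib br lx; rewrite le_eqVlt => /predU1P[->//|xy] yh.
have /andP[Fx1 Fx2] := br_range br lx (le_trans (ltW xy) yh).
have /andP[Fy1 Fy2] := br_range br (le_trans lx (ltW xy)) yh.
apply: h_inj_le => //; rewrite leNgt; apply/negP => H.
have := br_contr br lx (ltW xy) yh.
have := hmono (le_trans alo lx) xy (le_trans yh hib).
move=> h1 h2; have : k * (h (F x) - h (F y)) <= 0 by rewrite mulr_ge0_le0 // subr_le0 ltW.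
lra.
Qed.

(** Take [[f, x']] maximal among the bad intervals starting at [f].
    Inside the branch, [B] maps it to a bad interval ending at [f], and [B \o B]
    to one starting at [f] and longer by [k ^- 2], against maximality. So one of
    them covers a whole half of the branch, and the image of that half is
    everything on the other side of [f]. *)
Lemma fixpt_bad_right B p q f k x : 0 <= k -> k < 1 -> al <= p -> p < f -> f < q -> q <= be ->
  branch bad h al be B p q k -> B p = be -> B q = al -> B f = f ->
  f < x -> x <= be -> bad f x -> bad al be.
Proof.
move=> k0 k1 alp pf fq qbe brB Bp Bq Bf fx xb bx.
have fb : f <= be by lra.
have [x' [fx' x'b bx' max]] := extend_right fb.
have xx' : x <= x' by apply: max; [lra| |].
have fx2 : f < x' by lra.
have left_all : bad p f -> bad f be.
  by move=> b1; rewrite -Bp -[f in bad f _]Bf; apply: (br_bad brB) => //; lra.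
have [qx|xq] := lerP q x'.
  have b1 : bad al f.
    rewrite -Bq -[f in bad _ f]Bf; apply: (br_bad brB); [lra|lra|lra|].
    exact: (badW bf bx').
  by apply: (badU bf b1 (left_all (badW bf b1 alp (lexx _)))).
have b1 : bad (B x') f by rewrite -[f in bad _ f]Bf; apply: (br_bad brB) => //; lra.
have /andP[Bx1 Bx2] : al <= B x' <= be by apply: (br_range brB); lra.
have Bxf : B x' <= f by rewrite -[f in _ <= f]Bf; apply: (br_anti k0 alp qbe brB); lra.
have [Bp'|Bp'] := lerP (B x') p.
  have := max be fb (lexx _) (left_all (badW bf b1 Bp' (lexx _))); lra.
have b2 : bad f (B (B x')).
  by rewrite -[f in bad f _]Bf; apply: (br_bad brB) => //; [exact: ltW|lra].
have /andP[B2x1 B2x2] : al <= B (B x') <= be by apply: (br_range brB); lra.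
have fB2 : f <= B (B x') by rewrite -[f in f <= _]Bf; apply: (br_anti k0 alp qbe brB); lra.
have B2x := max _ fB2 B2x2 b2.
have c1 : h x' - h f <= k * (h f - h (B x')).
  by have := br_contr brB (ltW pf) (ltW fx2) (ltW xq); rewrite Bf.
have c2 : h f - h (B x') <= k * (h (B (B x')) - h f).
  by have := br_contr brB (ltW Bp') Bxf (ltW fq); rewrite Bf.
have m1 : h f < h x' by apply: hmono; lra.
have m2 : h (B (B x')) <= h x' by apply: hle; lra.
have c3 : h f - h (B x') <= k * (h x' - h f) by apply: le_trans c2 _; rewrite ler_wpM2l //; lra.
have c4 : k * (h x' - h f) < h x' - h f by rewrite gtr_pMl //; lra.
have c5 : k * (h f - h (B x')) <= k * (h x' - h f) by rewrite ler_wpM2l //; lra.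
by lra.
Qed.

(** One application of [B] moves the interval to the other side of [f]. *)
Lemma fixpt_bad_left B p q f k x : 0 <= k -> k < 1 -> al <= p -> p < f -> f < q -> q <= be ->
  branch bad h al be B p q k -> B p = be -> B q = al -> B f = f ->
  al <= x -> x < f -> bad x f -> bad al be.
Proof.
move=> k0 k1 alp pf fq qbe brB Bp Bq Bf ax xf bx.
pose y := Num.max x p.
have yf : y < f by rewrite gt_max xf.
have py : p <= y by rewrite le_max lexx orbT.
have b1 : bad y f by apply: (badW bf bx) => //; rewrite le_max lexx.
have b2 : bad f (B y) by rewrite -[f in bad f _]Bf; apply: (br_bad brB) => //; lra.
have /andP[By1 By2] : al <= B y <= be by apply: (br_range brB); lra.
apply: (fixpt_bad_right k0 k1 alp pf fq qbe brB Bp Bq Bf) b2 => //.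
have : h f - h y <= k * (h (B y) - h f).
  by have := br_contr brB py (ltW yf) (ltW fq); rewrite Bf.
have : h y < h f by apply: hmono; lra.
move=> m1 m2; rewrite ltNge; apply/negP => H.
have : h (B y) <= h f by apply: hle; lra.
move=> m3; have : k * (h (B y) - h f) <= 0 by rewrite mulr_ge0_le0 // subr_le0.
lra.
Qed.

(** The two pieces of a bad interval cut at [p] are mapped to bad intervals
    attached to [al] and to [be], which lie in the maximal ones [[al, l]] and
    [[r, be]]. *)
Lemma cut_length F G lo p hi kF kG l r x y : 0 <= kF -> 0 <= kG ->
  al <= lo -> hi <= be -> al <= l -> l <= be -> al <= r -> r <= be ->
  (forall x, al <= x -> x <= be -> bad al x -> x <= l) ->
  (forall x, al <= x -> x <= be -> bad x be -> r <= x) ->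
  branch bad h al be F lo p kF -> branch bad h al be G p hi kG -> F p = al -> G p = be ->
  lo <= x -> x < p -> p < y -> y <= hi -> bad x y ->
  h y - h x <= kF * (h l - h al) + kG * (h be - h r).
Proof.
move=> kF0 kG0 alo hib all lbe arr rbe maxl minr brF brG Fp Gp lx xp py yh bxy.
have b1 : bad al (F x).
  by rewrite -Fp; apply: (br_bad brF); [lra|lra|lra|apply: (badW bf bxy)]; lra.
have b2 : bad (G y) be.
  by rewrite -Gp; apply: (br_bad brG); [lra|lra|lra|apply: (badW bf bxy)]; lra.
have /andP[F1 F2] : al <= F x <= be by apply: (br_range brF); lra.
have /andP[G1 G2] : al <= G y <= be by apply: (br_range brG); lra.
have Fl := maxl _ F1 F2 b1.
have Gr := minr _ G1 G2 b2.
have c1 : h p - h x <= kF * (h (F x) - h al) by rewrite -Fp; apply: (br_contr brF); lra.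
have c2 : h y - h p <= kG * (h be - h (G y)) by rewrite -Gp; apply: (br_contr brG); lra.
have d1 : kF * (h (F x) - h al) <= kF * (h l - h al).
  by rewrite ler_wpM2l // lerB // hle.
have d2 : kG * (h be - h (G y)) <= kG * (h be - h r).
  by rewrite ler_wpM2l // lerB // hle.
lra.
Qed.

Definition bound_all M := forall x y, al <= x -> x <= y -> y <= be -> bad x y -> h y - h x <= M.

(** If every bound on the lengths of bad intervals can be improved, the
    supremum of these lengths is smaller than itself unless there is nothing to
    bound. *)
Lemma bound_contr : al <= be ->
  (forall M, 0 < M -> bound_all M -> exists2 M', M' < M &
     (forall x y, al <= x -> x < y -> y <= be -> bad x y -> h y - h x <= M')) ->
  forall x y, al <= x -> x < y -> y <= be -> ~ bad x y.
Proof.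
move=> ab H x0 y0 ax0 xy0 yb0 b0.
pose S := [set t | exists x y, [/\ al <= x, x < y, y <= be, bad x y & t = h y - h x]].
apply: (@sup_contr S).
- by exists (h y0 - h x0), x0, y0.
- exists (h be - h al) => _ [x [y [ax xy yb _ ->]]].
  by apply: lerB; apply: hle => //; lra.
- by move=> _ [x [y [ax xy yb _ ->]]]; rewrite subr_gt0 hmono.
- move=> M M0 ub.
  have [|M' lt H'] := H _ M0.
    move=> x y ax; rewrite le_eqVlt => /predU1P[->|xy] yb bxy; first by rewrite subrr ltW.
    by apply: ub; exists x, y.
  by exists M' => // _ [x [y [ax xy yb bxy ->]]]; apply: H'.
Qed.

End Family.
End BadFamilies.

Section ContractionConditions.
Context {R : realFieldType}.
Implicit Types a b c : R.

(** The conditions on the rates [a], [b], [c] of three consecutive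
    branches that make all the length estimates of [three_branch] strict. *)
Definition contracting3 a b c := [/\ a ^+ 2 + b * c < 1, a * b ^+ 2 + c ^+ 2 < 1,
  a * b ^+ 3 + c < 1 & a ^+ 2 * b + b <= 1].

End ContractionConditions.

Section ThreeBranches.
Context {R : realType}.
Implicit Types (bad : R -> R -> Prop) (h F : R -> R).

(** Here and in [arith_M], [z] and [w] stand for the lengths of the maximal
    bad intervals attached to the left and to the right end. When each is
    bounded by the other, with a product of factors less than 1, both vanish. *)
Lemma arith_fix (a b c z w : R) n : 0 <= a -> 0 <= b -> w <= b * z + c * w ->
  z <= a * b ^+ n * w ->
   a * b ^+ n.+1 + c < 1 -> 0 <= w -> 0 <= z -> w = 0 /\ z = 0.
Proof.
move=> a0 b0 h1 h2 h3 w0 z0.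
have : b * z <= b * (a * b ^+ n * w) by rewrite ler_wpM2l.
have -> : b * (a * b ^+ n * w) = a * b ^+ n.+1 * w by rewrite exprS; ring.
move=> h4; have w1 : w <= 0.
  rewrite leNgt; apply/negP => wp.
  have : (a * b ^+ n.+1 + c) * w < w by rewrite gtr_pMl.
  lra.
have w_ : w = 0 by apply/eqP; rewrite eq_le w1.
by split=> //; apply/eqP; rewrite eq_le z0 andbT; move: h2; rewrite w_ mulr0.
Qed.

(** The situation in which the image of the left end interval falls into the
    second branch; [M] bounds the lengths of all bad intervals. *)
Lemma arith_M (a b c z w M : R) : 0 <= a -> 0 < b -> b <= 1 -> 0 < M ->
   w <= b * z + c * w -> z <= a * b * M ->
   (a * b ^+ 2 + c < 1) \/ (b * z <= a * b ^+ 3 * M) -> a * b ^+ 3 + c < 1 ->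
   a ^+ 2 * b + b <= 1 -> c < 1 ->
   w < M /\ a * z + b * w < M.
Proof.
move=> a0 b0 b1 M0 h1 h2 h3 h5 h6 c1.
have [t tc bz] : exists2 t, t + c < 1 & b * z <= t * M.
  case: h3 => [h|h]; [exists (a * b ^+ 2) => // | by exists (a * b ^+ 3)].
  have : b * z <= b * (a * b * M) by rewrite ler_wpM2l // ltW.
  by move/le_trans; apply; rewrite expr2 !mulrA (mulrC b a).
have wM : w < M.
  rewrite ltNge; apply/negP => Mw.
  have k1 : (1 - c) * M <= (1 - c) * w by rewrite ler_wpM2l // subr_ge0 ltW.
  have k2 : t * M < (1 - c) * M by rewrite ltr_pM2r // ltrBrDr.
  clear - k1 k2 h1 bz; lra.
split=> //.
have k1 : a * z <= a * (a * b * M) by rewrite ler_wpM2l.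
have k2 : b * w < b * M by rewrite ltr_pM2l.
have k3 : (a ^+ 2 * b + b) * M <= M by rewrite ger_pMl.
clear - k1 k2 k3; lra.
Qed.

Section Family.
Context (bad : R -> R -> Prop) (bf : bad_family bad) (h : R -> R) (al be : R).
Hypothesis hm : forall x y, al <= x -> x < y -> y <= be -> h x < h y.

Lemma br_step F lo hi k x y : 0 <= k -> al <= lo -> hi <= be -> branch bad h al be F lo hi k ->
  lo <= x -> x <= y -> y <= hi -> bad x y ->
  [/\ al <= F y, F y <= F x, F x <= be, bad (F y) (F x) & h y - h x <= k * (h (F x) - h (F y))].
Proof.
move=> k0 alo hib br lx xy yh bxy.
have /andP[_ Fx] := br_range br lx (le_trans xy yh).
have /andP[Fy _] := br_range br (le_trans lx xy) yh.
split=> //; first exact: (br_anti hm k0 alo hib br).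
  exact: (br_bad br).
exact: (br_contr br).
Qed.

Lemma br_bound F lo hi k M x y : 0 <= k -> al <= lo -> hi <= be -> branch bad h al be F lo hi k ->
  bound_all bad h al be M -> lo <= x -> x <= y -> y <= hi -> bad x y -> h y - h x <= k * M.
Proof.
move=> k0 alo hib br HM lx xy yh bxy.
have [h1 h2 h3 h4 h5] := br_step k0 alo hib br lx xy yh bxy.
by apply: le_trans h5 _; rewrite ler_wpM2l //; apply: HM.
Qed.

(** A bad interval lies in one branch, or crosses exactly one cut point:
    crossing both would make the full branch, hence everything, bad. *)
Lemma three_bound p q A B C a b c X Y M : al < p -> p < q -> q < be ->
  0 <= a -> 0 <= b -> 0 <= c -> a < 1 -> b < 1 -> c < 1 ->
  branch bad h al be A al p a -> branch bad h al be B p q b -> branch bad h al be C q be c ->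
  0 < M -> bound_all bad h al be M -> ~ bad p q -> X < M -> Y < M ->
  (forall x y, al <= x -> x < p -> p < y -> y <= q -> bad x y -> h y - h x <= X) ->
  (forall x y, p <= x -> x < q -> q < y -> y <= be -> bad x y -> h y - h x <= Y) ->
  exists2 M', M' < M & forall x y, al <= x -> x < y -> y <= be -> bad x y -> h y - h x <= M'.
Proof.
move=> alp pq qbe a0 b0 c0 a1 b1 c1 brA brB brC M0 HM full XM YM HX HY.
exists (Num.max (Num.max X Y) (Num.max (a * M) (Num.max (b * M) (c * M)))).
  by rewrite !gt_max XM YM !gtr_pMl // a1 b1 c1.
move=> x y ax xy yb bxy; rewrite !le_max.
have pbe := lt_trans pq qbe; have alq := lt_trans alp pq.
have [yp|py] := lerP y p.
  by rewrite (br_bound a0 _ (ltW pbe) brA HM ax (ltW xy) yp bxy) ?orbT.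
have [px|xp] := lerP p x.
  have [yq|qy] := lerP y q.
    by rewrite (br_bound b0 (ltW alp) (ltW qbe) brB HM px (ltW xy) yq bxy) ?orbT.
  have [qx|xq] := lerP q x.
    by rewrite (br_bound c0 (ltW alq) _ brC HM qx (ltW xy) yb bxy) ?orbT.
  by rewrite HY ?orbT.
rewrite HX // leNgt; apply/negP => qy; apply: full.
by apply: (badW bf bxy); exact: ltW.
Qed.

(** The map [A \o B] sends [q] to [A al] and [r] to a point not below [r].
    It is expanding, so that [A al] is at least as far above [A (B r)] as [q] is
    above [r]. *)
Lemma first_image_ge_cut p q A B a b l r : al < p -> p < q -> q < be -> 0 <= a -> 0 <= b ->
  a < 1 -> b < 1 ->
  branch bad h al be A al p a -> branch bad h al be B p q b -> B q = al ->
  p <= r -> r <= q -> B r <= l -> l <= p -> r <= A l -> q <= A al.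
Proof.
move=> alp pq qbe a0 b0 a1 b1 brA brB Bq pr rq Brl lp rAl.
have pbe := ltW (lt_trans pq qbe).
have /andP[Br1 Br2] := br_range brB pr rq.
have Brp := le_trans Brl lp.
have /andP[Aa1 Aa2] := br_range brA (lexx _) (ltW alp).
have ABr := br_anti hm a0 (lexx al) pbe brA Br1 Brl lp.
have /andP[ABr1 ABr2] := br_range brA Br1 Brp.
have d1 := br_contr brA (lexx al) Br1 Brp.
have d2 := br_contr brB pr rq (lexx q); rewrite Bq in d2.
have alr := le_trans (ltW alp) pr.
have d3 := hle hm alr (le_trans rAl ABr) ABr2.
have d4 := hle hm ABr1 (br_anti hm a0 (lexx al) pbe brA (lexx _) Br1 Brp) Aa2.
apply: (h_inj_le hm) => //; first exact: ltW.
have d5 : b * (h (B r) - h al) <= h (B r) - h al.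
  by apply: ler_piMl (ltW b1); rewrite subr_ge0; apply: (hle hm).
have d6 : a * (h (A al) - h (A (B r))) <= h (A al) - h (A (B r)).
  by apply: ler_piMl (ltW a1); rewrite subr_ge0.
clear - d1 d2 d3 d4 d5 d6; lra.
Qed.

End Family.

(** Let [[al, l]] and [[r, be]] be the maximal bad intervals at the
    ends, of lengths [z] and [w] in the coordinate [h]; both stay on their side of
    [f], and the image [[A l, A al]] of the first lies to the right of [f], as
    [f <= A al]. If [q <= r], the second lies in the last branch and
    [w <= c * M], where [M] bounds the lengths of all bad intervals. If [r < q],
    then [w <= b * z + c * w], and [[A l, A al]] is compared with [r], which it
    cannot contain inside since [[r, be]] is maximal. To the right of [r] it gives
    [z <= a * w], and forces [q <= A al]. To the left of [r] it lies in the middle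
    branch, which is then applied once or twice more: [z] is at most [a * b * M],
    or [a * b ^+ 3 * M], or again a multiple of [w]. *)
Lemma three_branch bad h al p q be A B C f a b c :
  bad_family bad -> (forall x y, al <= x -> x < y -> y <= be -> h x < h y) ->
  al < p -> p < f -> f < q -> q < be -> 0 <= a -> 0 < b -> 0 <= c -> a < 1 -> b < 1 ->
  branch bad h al be A al p a -> branch bad h al be B p q b -> branch bad h al be C q be c ->
  A p = al -> B p = be -> B q = al -> C q = be -> B f = f -> f <= A al ->
  contracting3 a b c -> (B (A al) < p -> a * b ^+ 2 + c < 1) -> (q <= A al -> a * b + c < 1) ->
  forall x y, al <= x -> x < y -> y <= be -> bad x y -> bad al be.
Proof.
move=> bf hm alp pf fq qbe a0 b0 c0 a1 b1 brA brB brC Ap Bp Bq Cq Bf fA [h1 h2 h3 h6] h4 h5 x0 y0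
  ax0 xy0 yb0 bad00.
apply: contrapT => nb.
have c1 : c < 1 by apply: le_lt_trans h3; rewrite lerDr mulr_ge0 // exprn_ge0 // ltW.
have b0' := ltW b0; have b1' := ltW b1.
have qbe' := ltW qbe; have alp' := ltW alp.
have fl := fixpt_bad_left bf hm b0' b1 alp' pf fq qbe' brB Bp Bq Bf.
have fr := fixpt_bad_right bf hm b0' b1 alp' pf fq qbe' brB Bp Bq Bf.
have pq := lt_trans pf fq; have pq' := ltW pq.
have pf' := ltW pf; have fq' := ltW fq.
have pbe : p <= be := le_trans pq' qbe'.
have alq : al <= q := le_trans alp' pq'.
have alf : al <= f := le_trans alp' pf'.
have fbe : f < be := lt_trans fq qbe.
have albe : al <= be := le_trans alq qbe'.
have full : ~ bad p q by move=> bpq; apply: nb; rewrite -Bp -Bq; apply: (br_bad brB).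
have [l [all lbe bl maxl]] := extend_right bf albe.
have [r [alr rbe br minr]] := extend_left bf albe.
have hle' := hle hm.
have lp : l <= p.
  rewrite leNgt; apply/negP => pl; apply: nb; apply: (fl p) => //.
  apply: (badW bf (_ : bad al (A al)) _ fA); last exact: alp'.
  by rewrite -{1}Ap; apply: (br_bad brA) => //; apply: (badW bf bl) => //; exact: ltW.
have fr' : f <= r.
  rewrite leNgt; apply/negP => rf; apply: nb; apply: (fr be) => //.
  by apply: (badW bf br) => //; exact: ltW.
have [Al1 AlA Aa2 bA zA] := br_step hm a0 (lexx al) pbe brA (lexx _) all lp bl.
have Al2 := le_trans AlA Aa2; have Aa1 := le_trans Al1 AlA.
have fAl : f <= A l.
  rewrite leNgt; apply/negP => Alf; apply: nb; apply: (fl (A l)) => //.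
  by apply: (badW bf bA).
have cutp := cut_length bf hm a0 b0' (lexx al) qbe' all lbe alr rbe maxl minr brA brB Ap Bp.
have cutq := cut_length bf hm b0' c0 alp' (lexx be) all lbe alr rbe maxl minr brB brC Bq Cq.
have z0 : 0 <= h l - h al by rewrite subr_ge0 hle'.
have w0 : 0 <= h be - h r by rewrite subr_ge0 hle'.
have rw t : r <= t -> t <= be -> h be - h t <= h be - h r by move=> *; rewrite lerB // hle'.
have rw2 s t : r <= s -> s <= t -> t <= be -> h t - h s <= h be - h r.
  by move=> rs st tb; apply: lerB; apply: hle' => //; [exact: le_trans alr (le_trans rs st) |
    exact: le_trans st tb].
have lz t : al <= t -> t <= l -> h t - h al <= h l - h al by move=> *; rewrite lerB // hle'.
have wE : h be - h r = (h be - h q) + (h q - h r) by rewrite addrA subrK.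
move: (h l - h al) (h be - h r) => z w in zA z0 w0 cutp cutq rw rw2 lz wE.
apply: (bound_contr hm albe _ ax0 xy0 yb0 bad00) => M M0 HM.
(* Bad intervals crossing [p] are bounded by [a * z + b * w]. Those crossing [q]
   are bounded by [b * z + c * w], and when [r < q] also by [w], since they then
   merge with [[r, be]]. *)
suff [pM qM] : a * z + b * w < M /\ (b * z + c * w < M \/ r < q /\ w < M).
  apply: (three_bound bf hm alp pq qbe a0 b0' c0 a1 b1 c1 brA brB brC M0 HM full pM
    (_ : (if b * z + c * w < M then b * z + c * w else w) < M)) => //.
    by case: ifPn => // /negP k; case: qM => [//|[]].
  move=> x y px xq qy yb bxy; case: ifPn => [_|/negP k]; first exact: cutq.
  case: qM => // -[rq wM].
  have ax := le_trans alp' px.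
  have bxbe : bad x be by apply: (badU bf bxy br); exact: ltW (lt_trans rq qy).
  by apply: rw2 => //; [apply: minr => //; exact: le_trans (ltW xq) qbe'|exact: ltW (lt_trans xq
    qy)].
have AlS Aq := br_step hm b0' alp' qbe' brB (le_trans pf' fAl) AlA Aq bA.
have zM : z <= a * M by apply: le_trans zA _; rewrite ler_wpM2l //; apply: HM.
have zAB : A al <= q -> z <= a * b * (h (B (A l)) - h (B (A al))).
  by move=> /AlS[_ _ _ _ k]; apply: le_trans zA _; rewrite -mulrA ler_wpM2l.
have zabM : A al <= q -> z <= a * b * M.
  move=> Aq; apply: le_trans (zAB Aq) _; rewrite ler_wpM2l ?mulr_ge0 //.
  by have [? ? ? ? _] := AlS Aq; apply: HM.
have [rq|qr] : r < q \/ q <= r by case: (ltrP r q) => ?; [left|right].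
2: {
  have wM : h be - h r <= c * M.
    exact: (br_bound hm c0 alq (lexx be) brC HM qr rbe (lexx be) br).
  have wcM : w <= c * M by apply: le_trans wM; rewrite wE -addrA (addrA (- _)) addNr add0r.
  clear - a0 b0 b0' c0 c1 h1 h2 h5 zM zabM wcM M0 z0.
  have aw : a * z <= a * (a * M) by rewrite ler_wpM2l.
  have bw : b * w <= b * (c * M) by rewrite ler_wpM2l.
  have cw : c * w <= c * (c * M) by rewrite ler_wpM2l.
  split.
    have : (a ^+ 2 + b * c) * M < M by rewrite gtr_pMl.
    clear - aw bw; lra.
  left; have [Aq|qA] := lerP (A al) q.
    have bz : b * z <= b * (a * b * M) by rewrite ler_wpM2l // zabM.
    have : (a * b ^+ 2 + c ^+ 2) * M < M by rewrite gtr_pMl.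
    clear - bz cw; lra.
  have bz : b * z <= b * (a * M) by rewrite ler_wpM2l.
  have k1 : (a * b + c) * M < M by rewrite gtr_pMl // h5 // ltW.
  have k2 : c * (c * M) <= c * M by rewrite ler_wpM2l // ger_pMl // ltW.
  clear - bz cw k1 k2; lra. }
have rq' := ltW rq.
have [C1 _ _ bC yw] := br_step hm c0 alq (lexx be) brC (lexx q) qbe' (lexx be) (badW bf br rq'
  (lexx be)).
rewrite Cq in bC yw.
have Cb : C be <= be by have /andP[] := br_range brC qbe' (lexx be).
have rC : r <= C be by apply: minr.
have pr : p <= r := le_trans pf' fr'.
have [_ Br1 Br2 bB sz] := br_step hm b0' alp' qbe' brB pr rq' (lexx q) (badW bf br (lexx r) qbe').
rewrite Bq in Br1 bB sz.
have Brl : B r <= l by apply: maxl.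
have E1 : w <= b * z + c * w.
  rewrite {1}wE addrC; apply: lerD.
    by apply: le_trans sz _; rewrite ler_wpM2l // lz.
  by apply: le_trans yw _; rewrite ler_wpM2l // rw.
have zero : w = 0 /\ z = 0 -> a * z + b * w < M /\ (b * z + c * w < M \/ r < q /\ w < M).
  by case=> -> ->; rewrite !mulr0 !addr0; split => //; left.
have [rAl|Alr] := lerP r (A l).
  apply: zero; apply: (@arith_fix a b c z w 0) => //.
    by rewrite expr0 mulr1; apply: le_trans zA _; rewrite ler_wpM2l // rw2.
  rewrite expr1; apply: h5.
  exact: (first_image_ge_cut hm alp pq qbe a0 b0' a1 b1 brA brB Bq pr rq' Brl lp rAl).
have Ar : A al <= r.
  rewrite leNgt; apply/negP => rA.
  have : bad (A l) be by apply: (badU bf bA br); exact: ltW.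
  by move/(minr _ Al1 Al2); rewrite leNgt Alr.
have Aq : A al <= q := le_trans Ar rq'.
have [B1 B2 B3 bBA _] := AlS Aq.
have BAf : B (A l) <= f.
  by rewrite -[X in _ <= X]Bf; apply: (br_anti hm b0' alp' qbe' brB) => //; exact: le_trans AlA
    Aq.
suff : (w = 0 /\ z = 0) \/ (b * z <= a * b ^+ 3 * M) \/ (B (A al) < p).
  case=> [|H]; first exact: zero.
  have zab := zabM Aq.
  have [t1 t2] : w < M /\ a * z + b * w < M.
    by apply: (@arith_M a b c z w M) => //; case: H => H; [right|left => //; apply: h4].
  by split=> //; right.
have [pB|Bp'] := lerP p (B (A al)); last by right; right.
have [D1 D2 D3 bD c3] := br_step hm b0' alp' qbe' brB pB B2 (le_trans BAf fq') bBA.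
have z3 : z <= a * b ^+ 2 * (h (B (B (A al))) - h (B (B (A l)))).
  apply: le_trans (zAB Aq) _.
  have -> : a * b ^+ 2 = a * b * b by rewrite expr2 mulrA.
  by rewrite -[X in _ <= X]mulrA ler_wpM2l // mulr_ge0.
have fBB : f <= B (B (A l)).
  by rewrite -[X in X <= _]Bf; apply: (br_anti hm b0' alp' qbe' brB) => //; exact: le_trans B2.
have ab2 : 0 <= a * b ^+ 2 by rewrite mulr_ge0 // exprn_ge0.
have [rB|Br] := lerP r (B (B (A l))).
  left; apply: (@arith_fix a b c z w 2) => //.
  by apply: le_trans z3 _; rewrite ler_wpM2l // rw2.
have Br' : B (B (A al)) <= r.
  rewrite leNgt; apply/negP => rA.
  have : bad (B (B (A l))) be by apply: (badU bf bD br); exact: ltW.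
  by move/(minr _ D1 (le_trans D2 D3)); rewrite leNgt Br.
right; left.
have k := br_bound hm b0' alp' qbe' brB HM (le_trans pf' fBB) D2 (le_trans Br' rq') bD.
have k2 : z <= a * b ^+ 2 * (b * M) by apply: le_trans z3 _; rewrite ler_wpM2l.
have k3 : b * z <= z by rewrite ler_piMl.
apply: le_trans k3 (le_trans k2 _).
by rewrite [in X in _ <= X]exprSr !mulrA.
Qed.

End ThreeBranches.

Section FourBranches.
Context {R : realType}.
Implicit Types (bad : R -> R -> Prop) (h F : R -> R).

(** With four branches the rates are smaller and the crude bounds
    [z <= a * M] and [w <= M] for the lengths of the bad intervals at the ends
    already suffice. *)
Lemma four_branch bad h al p1 p2 p3 be A B C D f a b c d :
  bad_family bad -> (forall x y, al <= x -> x < y -> y <= be -> h x < h y) ->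
  al < p1 -> p1 < f -> f < p2 -> p2 < p3 -> p3 < be -> 0 <= a -> 0 <= b -> 0 <= c -> 0 <= d ->
  a < 1 -> b < 1 -> c < 1 -> d < 1 ->
  branch bad h al be A al p1 a -> branch bad h al be B p1 p2 b ->
  branch bad h al be C p2 p3 c -> branch bad h al be D p3 be d ->
  A p1 = al -> B p1 = be -> B p2 = al -> C p2 = be -> C p3 = al -> D p3 = be -> B f = f ->
  f <= A al ->
  a ^+ 2 + b < 1 -> a * b + c < 1 -> a * c + d < 1 ->
  forall x y, al <= x -> x < y -> y <= be -> bad x y -> bad al be.
Proof.
move=> bf hm alp pf fq p23 qbe a0 b0 c0 d0 a1 b1 c1 d1 brA brB brC brD Ap Bp Bq Cp Cq Dp Bf fA h1
  h2 h3 x0 y0 ax0 xy0 yb0 bad00.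
apply: contrapT => nb.
have p12 := lt_trans pf fq; have p12' := ltW p12; have p23' := ltW p23; have p3b := ltW qbe.
have alp' := ltW alp; have al2 := le_trans alp' p12'; have al3 := le_trans al2 p23'.
have p2b := le_trans p23' p3b; have p1b := le_trans p12' p2b.
have albe : al <= be := le_trans al2 p2b.
have fl := fixpt_bad_left bf hm b0 b1 alp' pf fq p2b brB Bp Bq Bf.
have fullB : ~ bad p1 p2 by move=> bpq; apply: nb; rewrite -Bp -Bq; apply: (br_bad brB).
have fullC : ~ bad p2 p3 by move=> bpq; apply: nb; rewrite -Cp -Cq; apply: (br_bad brC).
have [l [all lbe bl maxl]] := extend_right bf albe.
have [r [alr rbe br minr]] := extend_left bf albe.
have lp : l <= p1.
  rewrite leNgt; apply/negP => pl; apply: nb; apply: (fl p1) => //.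
  apply: (badW bf (_ : bad al (A al)) _ fA); last exact: alp'.
  by rewrite -{1}Ap; apply: (br_bad brA) => //; apply: (badW bf bl) => //; exact: ltW.
apply: (bound_contr hm albe _ ax0 xy0 yb0 bad00) => M M0 HM.
have zM : h l - h al <= a * M by exact: (br_bound hm a0 (lexx _) p1b brA HM (lexx _) all lp bl).
have wM : h be - h r <= M by exact: HM.
have cut1 := cut_length bf hm a0 b0 (lexx al) p2b all lbe alr rbe maxl minr brA brB Ap Bp.
have cut2 := cut_length bf hm b0 c0 alp' p3b all lbe alr rbe maxl minr brB brC Bq Cp.
have cut3 := cut_length bf hm c0 d0 al2 (lexx be) all lbe alr rbe maxl minr brC brD Cq Dp.
have comb s t : 0 <= s -> 0 <= t -> s * (h l - h al) + t * (h be - h r) <= (a * s + t) * M.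
  move=> s0 t0; rewrite mulrDl (mulrC a) -mulrA.
  by apply: lerD; apply: ler_wpM2l.
exists (Num.max (Num.max (a * M) (b * M)) (Num.max (Num.max (c * M) (d * M))
   (Num.max ((a * a + b) * M) (Num.max ((a * b + c) * M) ((a * c + d) * M))))).
  by rewrite !gt_max !gtr_pMl // a1 b1 c1 d1 h2 h3 -expr2 h1.
move=> x y ax xy yb bxy; rewrite !le_max.
have [y1|y1] := lerP y p1.
  by rewrite (br_bound hm a0 (lexx _) p1b brA HM ax (ltW xy) y1 bxy) ?orbT.
have [x1|x1] := lerP p1 x; last first.
  have y2 : y <= p2 by rewrite leNgt; apply/negP => ?; apply: fullB; apply: (badW bf bxy); exact:
    ltW.
  by rewrite (le_trans (cut1 _ _ ax x1 y1 y2 bxy) (comb _ _ a0 b0)) ?orbT.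
have [y2|y2] := lerP y p2.
  by rewrite (br_bound hm b0 alp' p2b brB HM x1 (ltW xy) y2 bxy) ?orbT.
have [x2|x2] := lerP p2 x; last first.
  have y3 : y <= p3 by rewrite leNgt; apply/negP => ?; apply: fullC; apply: (badW bf bxy); exact:
    ltW.
  by rewrite (le_trans (cut2 _ _ x1 x2 y2 y3 bxy) (comb _ _ b0 c0)) ?orbT.
have [y3|y3] := lerP y p3.
  by rewrite (br_bound hm c0 al2 p3b brC HM x2 (ltW xy) y3 bxy) ?orbT.
have [x3|x3] := lerP p3 x; last first.
  by rewrite (le_trans (cut3 _ _ x2 x3 y3 yb bxy) (comb _ _ c0 d0)) ?orbT.
by rewrite (br_bound hm d0 al3 (lexx _) brD HM x3 (ltW xy) yb bxy) ?orbT.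
Qed.

(** The reflection [x |-> - x] exchanges the two ends, so that the
    hypothesis at the right end reduces to the one at the left end. *)
Definition mirror_bad bad : R -> R -> Prop := fun x y => bad (- y) (- x).
Definition mirror_fun F : R -> R := fun x => - F (- x).

Lemma mirror_bad_family bad : bad_family bad -> bad_family (mirror_bad bad).
Proof.
rewrite /mirror_bad => bf; split.
- by move=> x y yx; apply: (bad0 bf); rewrite lerN2.
- by move=> x y x' y' bxy xx yy; apply: (badW bf bxy); rewrite lerN2.
- by move=> x y y' z b1 b2 yy; apply: (badU bf b2 b1); rewrite lerN2.
- by move=> x y H; apply: (bad_inf bf) => t; rewrite ltrNl => /H; rewrite opprK.
- by move=> x y H; apply: (bad_sup bf) => t; rewrite ltrNr => /H; rewrite opprK.
Qed.

Lemma mirror_branch bad h al be F lo hi k : branch bad h al be F lo hi k ->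
  branch (mirror_bad bad) (mirror_fun h) (- be) (- al) (mirror_fun F) (- hi) (- lo) k.
Proof.
rewrite /mirror_fun /mirror_bad => br; split.
- move=> x; rewrite lerNl lerNr => x1 x2.
  by have /andP[? ?] := br_range br x2 x1; rewrite !lerN2; apply/andP.
- move=> x y; rewrite lerNl lerNr => x1 xy y2.
  rewrite !opprK [- h (- y) + _]addrC [- h (F (- x)) + _]addrC.
  by apply: (br_contr br) => //; rewrite lerN2.
- move=> x y; rewrite lerNl lerNr => x1 xy y2 bxy.
  by rewrite !opprK; apply: (br_bad br) => //; rewrite lerN2.
Qed.

Lemma mirror_mono h al be : (forall x y, al <= x -> x < y -> y <= be -> h x < h y) ->
  forall x y, - be <= x -> x < y -> y <= - al -> mirror_fun h x < mirror_fun h y.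
Proof.
move=> hm x y; rewrite lerNl lerNr => x1 xy y2.
by rewrite /mirror_fun ltrN2; apply: hm => //; rewrite ltrN2.
Qed.

Lemma mirror_eq F x y : F x = y -> mirror_fun F (- x) = - y.
Proof. by move=> Fxy; rewrite /mirror_fun opprK Fxy. Qed.

Lemma three_branch_mirror bad h al p q be A B C f a b c :
  bad_family bad -> (forall x y, al <= x -> x < y -> y <= be -> h x < h y) ->
  al < p -> p < f -> f < q -> q < be -> 0 <= a -> 0 < b -> 0 <= c -> b < 1 -> c < 1 ->
  branch bad h al be A al p a -> branch bad h al be B p q b -> branch bad h al be C q be c ->
  A p = al -> B p = be -> B q = al -> C q = be -> B f = f -> C be <= f ->
  contracting3 c b a -> c * b ^+ 2 + a < 1 -> c * b + a < 1 ->
  forall x y, al <= x -> x < y -> y <= be -> bad x y -> bad al be.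
Proof.
move=> bf hm alp pf fq qbe a0 b0 c0 b1 c1 brA brB brC Ap Bp Bq Cq Bf fA w3 h4 h5 x y ax xy yb bxy.
have : mirror_bad bad (- be) (- al).
  apply: (three_branch (mirror_bad_family bf) (mirror_mono hm) _ _ _ _ c0 b0 a0 c1 b1
    (mirror_branch brC) (mirror_branch brB) (mirror_branch brA) (mirror_eq Cq) (mirror_eq Bq)
    (mirror_eq Bp) (mirror_eq Ap) (mirror_eq Bf) _ w3 (fun _ => h4) (fun _ => h5) (x:= -y) (y :=
      -x)) => //;
    rewrite ?ltrN2 ?lerN2 //.
  - by rewrite opprK.
  - by rewrite /mirror_bad !opprK.
by rewrite /mirror_bad !opprK.
Qed.

Lemma four_branch_mirror bad h al p1 p2 p3 be A B C D f a b c d :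
  bad_family bad -> (forall x y, al <= x -> x < y -> y <= be -> h x < h y) ->
  al < p1 -> p1 < p2 -> p2 < f -> f < p3 -> p3 < be -> 0 <= a -> 0 <= b -> 0 <= c -> 0 <= d ->
  a < 1 -> b < 1 -> c < 1 -> d < 1 ->
  branch bad h al be A al p1 a -> branch bad h al be B p1 p2 b ->
  branch bad h al be C p2 p3 c -> branch bad h al be D p3 be d ->
  A p1 = al -> B p1 = be -> B p2 = al -> C p2 = be -> C p3 = al -> D p3 = be -> C f = f ->
  D be <= f ->
  d ^+ 2 + c < 1 -> d * c + b < 1 -> d * b + a < 1 ->
  forall x y, al <= x -> x < y -> y <= be -> bad x y -> bad al be.
Proof.
move=> bf hm alp p12 pf fq qbe a0 b0 c0 d0 a1 b1 c1 d1 brA brB brC brD Ap Bp Bq Cp Cq Dp Cf fA h1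
  h2 h3 x y ax xy yb bxy.
have : mirror_bad bad (- be) (- al).
  apply: (four_branch (mirror_bad_family bf) (mirror_mono hm) _ _ _ _ _ d0 c0 b0 a0 d1 c1 b1 a1
    (mirror_branch brD) (mirror_branch brC) (mirror_branch brB) (mirror_branch brA)
    (mirror_eq Dp) (mirror_eq Cq) (mirror_eq Cp) (mirror_eq Bq)
    (mirror_eq Bp) (mirror_eq Ap) (mirror_eq Cf) _ h1 h2 h3 (x:= -y) (y := -x)) => //;
    rewrite ?ltrN2 ?lerN2 //.
  - by rewrite opprK.
  - by rewrite /mirror_bad !opprK.
by rewrite /mirror_bad !opprK.
Qed.
End FourBranches.

(** * Intervals missed by all iterates, and the projective coordinate *)

Section Coordinate.
Context {R : realType}.
Implicit Types (T : R -> R) (U : set R).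

Definition hits T U (x y : R) : Prop := exists s t n,
  [/\ x <= s, s < t, t <= y & forall z, s < z -> z < t -> U (iter n T z)].

Definition bad T U (x y : R) : Prop := ~ hits T U x y.

Lemma bad_familyP T U : bad_family (bad T U).
Proof.
split.
- move=> x y yx [s [t [n [xs st ty _]]]]; lra.
- by move=> x y x' y' b xx yy [s [t [n [xs st ty H]]]]; apply: b; exists s, t, n; split=> //; lra.
- move=> x y y' z b1 b2 yy [s [t [n [xs st tz H]]]].
  have [ys|sy] := lerP y s; first by apply: b2; exists s, t, n; split => //; lra.
  apply: b1; exists s, (Num.min t y), n; split=> //; first by rewrite lt_min st.
    by rewrite ge_min lexx orbT.
  by move=> u su; rewrite lt_min => /andP[ut _]; apply: H.
- move=> x y H [s [t [n [xs st ty HU]]]]; apply: (H ((s + t) / 2)); first lra.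
  exists s, ((s + t) / 2), n; split=> //; [lra|move=> z sz zt; apply: HU; lra].
- move=> x y H [s [t [n [xs st ty HU]]]]; apply: (H ((s + t) / 2)); first lra.
  exists ((s + t) / 2), t, n; split=> //; [lra|move=> z sz zt; apply: HU; lra].
Qed.

(** A hit in the image pulls back along the inverse branch
    [z |-> N / (z + i)], at the cost of one more iterate. *)
Lemma bad_step T U (N i lo hi x y : R) : 0 < N -> 0 < lo -> (forall z, lo < z -> z < hi ->
  T z = N / z - i) ->
  lo <= x -> x <= y -> y <= hi -> bad T U x y -> bad T U (N / y - i) (N / x - i).
Proof.
move=> N0 lo0 HT lx xy yh b [s [t [n [xs st ty HU]]]]; apply: b.
have x0 : 0 < x by lra.
have y0 : 0 < y by lra.
have Ny : 0 < N / y by rewrite divr_gt0.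
have si : 0 < s + i by lra.
have ti : 0 < t + i by lra.
have h1 : x <= N / (t + i) by rewrite ler_pdivlMr // mulrC -ler_pdivlMr //; lra.
have h2 : N / (s + i) <= y by rewrite ler_pdivrMr // mulrC -ler_pdivrMr //; lra.
exists (N / (t + i)), (N / (s + i)), n.+1; split => //.
  by rewrite ltr_pM2l // ltf_pV2 ?posrE //; lra.
move=> z z1 z2; have z0 : 0 < z by lra.
rewrite iterSr HT; [|lra|lra].
apply: HU.
- move: z2; rewrite ltr_pdivlMr // mulrC -ltr_pdivlMr //; lra.
- move: z1; rewrite ltr_pdivrMr // mulrC -ltr_pdivrMr //; lra.
Qed.

(** The coordinate in which the points [0] and [-c] become [0] and infinity,
    and which increases from 0 to 1 on the positive half-line. For [c] the
    opposite of the second fixed point of a branch, it makes that branch affine. *)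
Definition hfun (c x : R) := x / (x + c).

Lemma hfun_mono c al be : 0 < c -> 0 < al -> forall x y, al <= x -> x < y -> y <= be ->
  hfun c x < hfun c y.
Proof.
move=> c0 a0 x y ax xy yb; rewrite /hfun ltr_pdivrMr; last lra.
rewrite mulrAC ltr_pdivlMr; last lra. nra.
Qed.

(** With [X = h x] one has [F x + c = (x + c) * (f + j * X) / x], hence
    [h (F x) = 1 - c * X / (f + j * X)]. The right side is a Moebius function of
    [X], affine for [j = 0]. *)
Lemma hfun_expansion f c j x y (F := fun t => f * c / t - (c - f - j)) : 0 < f -> 0 < c ->
  0 < x -> 0 < y ->
  0 < F x -> 0 < F y ->
  hfun c y - hfun c x = (f + j * hfun c x) * (f + j * hfun c y) / (f * c) * (hfun c (F x) - hfun
    c (F y)).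
Proof.
move=> f0 c0 x0 y0 Fx Fy.
have e1 t : 0 < t -> 0 < F t -> hfun c (F t) = 1 - t * c / ((t + c) * (f + j * hfun c t))
   /\ 0 < f + j * hfun c t.
  move=> t0 Ft.
  have E : F t + c = (t + c) * (f + j * hfun c t) / t.
    by rewrite /F /hfun /=; field; rewrite !lt0r_neq0 //; lra.
  have pos : 0 < f + j * hfun c t.
    have : 0 < F t + c by lra.
    rewrite E pmulr_lgt0 ?invr_gt0 // pmulr_rgt0 //; lra.
  split => //; rewrite {1}/hfun -[X in X / _](addrK c) E.
  by field; rewrite !lt0r_neq0 //; lra.
have [-> px] := e1 x x0 Fx; have [-> py] := e1 y y0 Fy.
have xE : x * c / ((x + c) * (f + j * hfun c x)) = c * hfun c x / (f + j * hfun c x).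
  by rewrite {2}/hfun; field; rewrite !lt0r_neq0 //; lra.
have yE : y * c / ((y + c) * (f + j * hfun c y)) = c * hfun c y / (f + j * hfun c y).
  by rewrite {2}/hfun; field; rewrite !lt0r_neq0 //; lra.
rewrite xE yE; move: (hfun c x) (hfun c y) px py => X Y px py.
by field; rewrite !lt0r_neq0.
Qed.

Lemma branchP T U N f c j al be lo hi g k : 0 < f -> 0 < c -> N = f * c -> 0 < al ->
  al <= lo -> lo < hi -> hi <= be ->
  (forall z, lo < z -> z < hi -> T z = N / z - (c - f - j)) ->
  al <= N / hi - (c - f - j) -> N / lo - (c - f - j) <= be ->
  (forall x, lo <= x -> x <= hi -> f + j * hfun c x <= g) -> g ^+ 2 <= k * (f * c) ->
  branch (bad T U) (hfun c) al be (fun x => N / x - (c - f - j)) lo hi k.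
Proof.
move=> f0 c0 Nf a0 alo lohi hib HT H1 H2 Hg gk.
have N0 : 0 < N by rewrite Nf mulr_gt0.
have lo0 : 0 < lo by lra.
have rg x : lo <= x -> x <= hi -> al <= N / x - (c - f - j) <= be.
  move=> lx xh; have x0 : 0 < x by lra.
  have : N / hi <= N / x by rewrite ler_pM2l // lef_pV2 ?posrE //; lra.
  have : N / x <= N / lo by rewrite ler_pM2l // lef_pV2 ?posrE //; lra.
  move=> h1 h2; apply/andP; split; lra.
split=> //.
- move=> x y lx xy yh; have x0 : 0 < x by lra.
  have y0 : 0 < y by lra.
  have xh : x <= hi by lra.
  have ly : lo <= y by lra.
  have /andP[Fx _] := rg _ lx xh; have /andP[Fy1 Fy2] := rg _ ly yh.
  have Fx0 : 0 < f * c / x - (c - f - j) by rewrite -Nf; lra.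
  have Fy0 : 0 < f * c / y - (c - f - j) by rewrite -Nf; lra.
  have := hfun_expansion f0 c0 x0 y0 Fx0 Fy0; rewrite -Nf => ->.
  have posj t : 0 < t -> 0 < N / t - (c - f - j) -> 0 <= f + j * hfun c t.
    move=> t0 Ft.
    have E : N / t - (c - f - j) + c = (t + c) * (f + j * hfun c t) / t.
      by rewrite Nf /hfun; field; rewrite !lt0r_neq0 //; lra.
    have : 0 < N / t - (c - f - j) + c by lra.
    rewrite E pmulr_lgt0 ?invr_gt0 // pmulr_rgt0; [exact: ltW|lra].
  rewrite ler_wpM2r //.
    rewrite subr_ge0; apply: (hle (hfun_mono c0 a0 (be := be))) => //.
      by rewrite lerB // ler_pM2l // lef_pV2.
    by have /andP[] := rg _ lx xh.
  have fc0 : 0 < f * c by rewrite mulr_gt0.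
  rewrite Nf ler_pdivrMr //; apply: le_trans gk.
  have p1 : 0 <= f + j * hfun c x by apply: posj; rewrite // Nf.
  have p2 : 0 <= f + j * hfun c y by apply: posj; rewrite // Nf.
  by rewrite expr2; apply: ler_pM => //; apply: Hg.
- by move=> x y lx xy yh; apply: (bad_step N0 lo0 HT).
Qed.
End Coordinate.

(** * Digits, fixed points and cut points *)

Section Digits.
Context {R : realType}.
Implicit Types (N : nat) (alpha : R) (i d : int).

Lemma Tmap_itv N alpha i x : x != alpha -> i%:~R <= N%:R / x - alpha ->
  N%:R / x - alpha < i%:~R + 1 ->
  Tmap N alpha x = N%:R / x - i%:~R.
Proof.
move=> xa h1 h2; rewrite /Tmap /digit (negbTE xa) /=.
by rewrite (@floor_def _ _ i) // h1 intrD.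
Qed.

Lemma Tmap_alpha N alpha d : digit N alpha alpha = d ->
  [/\ Tmap N alpha alpha = N%:R / alpha - d%:~R, alpha < N%:R / alpha - d%:~R
    & N%:R / alpha - d%:~R <= alpha + 1].
Proof.
move=> hd; rewrite /Tmap hd; split=> //; move: hd; rewrite /digit eqxx /=; case: ifPn => H <-.
- have := floorK H; rewrite intrB => ->; lra.
- have /andP[h1 h2] := floor_itv (N%:R / alpha - alpha).
  move: h1; rewrite le_eqVlt => /predU1P[E|]; last by move=> ?; lra.
  by move: H; rewrite intrEfloor E eqxx.
- have := floorK H; rewrite intrB => ->; lra.
- have /andP[h1 h2] := floor_itv (N%:R / alpha - alpha).
  by move: h2; rewrite intrD => ?; lra.
Qed.

Lemma Tmap_beta N alpha d : digit N alpha (alpha + 1) = d ->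
  [/\ Tmap N alpha (alpha + 1) = N%:R / (alpha + 1) - d%:~R, alpha <= N%:R / (alpha + 1) - d%:~R
    & N%:R / (alpha + 1) - d%:~R < alpha + 1].
Proof.
have ne : (alpha + 1 == alpha) = false by apply/negP => /eqP ?; lra.
move=> hd; rewrite /Tmap hd; move: hd; rewrite /digit ne /= => <-.
have /andP[h1 h2] := floor_itv (N%:R / (alpha + 1) - alpha).
by move: h2; rewrite intrD => ?; split => //; lra.
Qed.

Lemma fixptP N i : (0 < N)%N ->
  0 < fixpt (R:=R) N i /\ fixpt N i * (fixpt N i + i%:~R) = N%:R :> R.
Proof.
move=> N0; rewrite /fixpt; set r := i%:~R.
have N0' : 0 < N%:R :> R by rewrite ltr0n.
have S0 : 0 <= 4 * N%:R + r ^+ 2 by have := sqr_ge0 r; lra.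
have s0 := sqrtr_ge0 (4 * N%:R + r ^+ 2).
have s2 := sqr_sqrtr S0.
move: (Num.sqrt _) s0 s2 => s s0 s2.
split; last by nra.
have : r < s by rewrite ltNge; apply/negP => k; nra.
lra.
Qed.

(** The bound on [alpha] says [alpha + 1 <= N / (alpha + 1)]. *)
Lemma last_digit_ge1 N alpha d : 0 < alpha -> alpha <= Num.sqrt N%:R - 1 ->
  N%:R / (alpha + 1) - d%:~R < alpha + 1 -> 1 <= d.
Proof.
move=> a0 aN h.
have s2 : (alpha + 1) ^+ 2 <= N%:R.
  have N0 : 0 <= N%:R :> R by [].
  by rewrite -(sqr_sqrtr N0) lerXn2r ?nnegrE ?sqrtr_ge0 //; lra.
have : alpha + 1 <= N%:R / (alpha + 1) by rewrite ler_pdivlMr -?expr2 //; lra.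
move=> k; have : 0 < d%:~R :> R by lra.
by rewrite ltr0z.
Qed.

(** At a point [x] outside [[N / (al + e + 1), N / (al + e)]] the value
    [N / x - e] is outside [[al, al + 1]], on the other side of [x]. *)
Lemma fixpt_full (N al e f : R) : 0 < al -> 0 < e -> 0 < f -> f * (f + e) = N ->
  al < N / (al + e + 1) -> N / (al + e) < al + 1 -> N / (al + e + 1) < f < N / (al + e).
Proof.
move=> a0 e0 f0 Nf h1 h2.
have N0 : 0 < N by rewrite -Nf mulr_gt0 //; lra.
have pq : N / (al + e + 1) < N / (al + e) by rewrite ltr_pM2l // ltf_pV2 ?posrE; lra.
apply/andP; split; rewrite ltNge; apply/negP => k.
- have : (al + e + 1) * f <= N by rewrite mulrC -ler_pdivlMr //; lra.
  rewrite -Nf mulrC ler_pM2l // => ?; lra.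
- have : N <= (al + e) * f by rewrite mulrC -ler_pdivrMr //; lra.
  rewrite -Nf mulrC ler_pM2r // => ?; lra.
Qed.

Lemma hfun_bounds (c al be x : R) : 0 < c -> 0 < al -> al <= x -> x <= be ->
  hfun c al <= hfun c x <= hfun c be.
Proof.
move=> c0 a0 ax xb; apply/andP; split; apply: (hle (hfun_mono c0 a0 (be := be))).
- exact: lexx.
- exact: ax.
- exact: xb.
- exact: ax.
- exact: xb.
- exact: lexx.
Qed.

Lemma hfunK (c x : R) : 0 < x + c -> hfun c x * (x + c) = x.
Proof. by move=> xc; rewrite /hfun divfK // lt0r_neq0. Qed.

Lemma hfun_ge0 (c x : R) : 0 < c -> 0 < x -> 0 <= hfun c x.
Proof. by move=> c0 x0; rewrite /hfun divr_ge0 // ltW // addr_gt0. Qed.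

End Digits.

Section CutPoints.
Context {R : realType}.
Implicit Types (N : nat) (alpha : R) (e i d : int) (U : set R).

(** The point where the digit drops from [i] to [i - 1]: the branch of digit [i]
    takes the value [alpha] there, and the branch of digit [i - 1] the value
    [alpha + 1]. *)
Definition cut N alpha i : R := N%:R / (alpha + i%:~R).

Lemma cut_den_gt0 alpha i : 0 < alpha -> 0 <= i -> 0 < alpha + i%:~R.
Proof. by move=> a0 i0; rewrite ltr_wpDr // ler0z. Qed.

Lemma cut_low N alpha i : (0 < N)%N -> 0 < alpha -> 0 <= i ->
  N%:R / cut N alpha i - i%:~R = alpha.
Proof.
move=> N0 a0 i0; have n0 : 0 < N%:R :> R by rewrite ltr0n.
have ai := cut_den_gt0 a0 i0.
by rewrite /cut; field; rewrite !lt0r_neq0.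
Qed.

Lemma cut_high N alpha i : (0 < N)%N -> 0 < alpha -> 0 <= i ->
  N%:R / cut N alpha (i + 1) - i%:~R = alpha + 1.
Proof.
move=> N0 a0 i0; have := cut_low N0 a0 (addr_ge0 i0 ler01).
by rewrite intrD opprD addrA => /eqP; rewrite subr_eq => /eqP.
Qed.

Lemma cut_anti N alpha i j : (0 < N)%N -> 0 < alpha -> 0 <= i -> i < j ->
  cut N alpha j < cut N alpha i.
Proof.
move=> N0 a0 i0 ij; have i1 := cut_den_gt0 a0 i0.
have j1 := cut_den_gt0 a0 (ltW (le_lt_trans i0 ij)).
by rewrite ltr_pM2l ?ltr0n // ltf_pV2 // ltrD2l ltr_int.
Qed.

Lemma cut_gt_alpha N alpha d : 0 < alpha -> 0 <= d -> digit N alpha alpha = d ->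
  alpha < cut N alpha d.
Proof.
move=> a0 d0 /Tmap_alpha[_ h _]; rewrite ltr_pdivlMr ?cut_den_gt0 //.
by rewrite mulrC -ltr_pdivlMr // -ltrBrDr.
Qed.

Lemma cut_lt_end N alpha d : 0 < alpha -> 0 <= d -> digit N alpha (alpha + 1) = d ->
  cut N alpha (d + 1) < alpha + 1.
Proof.
move=> a0 d0 /Tmap_beta[_ _ h]; have b0 : 0 < alpha + 1 by apply: addr_gt0.
have s0 := cut_den_gt0 a0 (addr_ge0 d0 ler01).
rewrite ltr_pdivrMr // mulrC -ltr_pdivrMr // -ltrBlDr.
by move: h; rewrite intrD; clear; lra.
Qed.

Lemma fixpt_cut N alpha e : (0 < N)%N -> 0 < alpha -> 1 <= e ->
  alpha < cut N alpha (e + 1) -> cut N alpha e < alpha + 1 ->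
  cut N alpha (e + 1) < fixpt N e < cut N alpha e.
Proof.
move=> N0 a0 e1; rewrite /cut intrD addrA.
have [f0 fN] := fixptP (R := R) e N0.
by apply: fixpt_full => //; rewrite ltr0z.
Qed.

Lemma digit_branch N alpha U e i lo hi g k f c : f = fixpt N e -> c = f + e%:~R ->
  (0 < N)%N -> 0 < alpha -> 0 <= e -> alpha <= lo -> lo < hi -> hi <= alpha + 1 ->
  alpha <= N%:R / hi - i%:~R -> N%:R / lo - i%:~R <= alpha + 1 ->
  (forall x, lo <= x -> x <= hi -> f + (e - i)%:~R * hfun c x <= g) -> g ^+ 2 <= k * N%:R ->
  branch (bad (Tmap N alpha) U) (hfun c) alpha (alpha + 1) (fun x => N%:R / x - i%:~R) lo hi k.
Proof.
move=> fE cE N0 a0 e0 alo lohi hib H1 H2 Hg gk.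
have n0 : 0 < N%:R :> R by rewrite ltr0n.
have [f0 fN] := fixptP (R := R) e N0; rewrite -fE -cE in f0 fN.
have c0 : 0 < c by rewrite cE ltr_wpDr // ler0z.
have iE : i%:~R = c - f - (e - i)%:~R :> R by rewrite cE intrB; ring.
rewrite -fN in gk; rewrite iE in H1 H2 *.
apply: (branchP _ f0 c0 (esym fN) a0 alo lohi hib _ H1 H2 Hg gk); rewrite -iE in H1 H2 *.
move=> z z1 z2; apply: Tmap_itv.
- by rewrite gt_eqF // (le_lt_trans alo).
- have z0 : 0 < z by apply: lt_trans z1; apply: lt_le_trans alo.
  have : N%:R / hi <= N%:R / z by rewrite ler_pM2l // lef_pV2 ?posrE ?(ltW z2) // (lt_trans z0).
  by move: H1; clear; lra.
- have lo0 : 0 < lo by apply: lt_le_trans alo.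
  have : N%:R / z < N%:R / lo by rewrite ltr_pM2l // ltf_pV2 ?posrE // (lt_trans lo0).
  by move: H2; clear; lra.
Qed.

(** Digits at least [e] are at least as expanding as the branch of [f]. *)
Lemma rate_low c alpha e i (f : R) : e <= i -> 0 < c -> 0 < alpha ->
  forall x, alpha <= x -> f + (e - i)%:~R * hfun c x <= f.
Proof.
move=> ei c0 a0 x ax; have x0 := lt_le_trans a0 ax.
have j0 : (e - i)%:~R <= 0 :> R by rewrite lerz0 subr_le0.
by rewrite gerDl mulr_le0_ge0 // hfun_ge0.
Qed.

Lemma rate_high c alpha be e i (f : R) : i <= e -> 0 < c -> 0 < alpha ->
  forall x, alpha <= x -> x <= be ->
  f + (e - i)%:~R * hfun c x <= f + (e - i)%:~R * hfun c be.
Proof.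
move=> ie c0 a0 x ax xb; rewrite lerD2l ler_wpM2l ?ler0z ?subr_ge0 //.
by have /andP[] := hfun_bounds c0 a0 ax xb.
Qed.

Lemma rate_first c alpha be e (f : R) : 0 < c -> 0 < alpha ->
  forall x, alpha <= x -> x <= be ->
  f + (e - (e + 1))%:~R * hfun c x <= f - hfun c alpha.
Proof.
move=> c0 a0 x ax xb; rewrite opprD addNKr mulN1r lerD2l lerN2.
by have /andP[] := hfun_bounds c0 a0 ax xb.
Qed.

Section DigitBranches.
Context (N : nat) (alpha : R) (U : set R) (e : int).
Hypotheses (N0 : (0 < N)%N) (a0 : 0 < alpha) (e0 : 0 <= e).
Let f : R := fixpt N e.
Let c : R := f + e%:~R.

Let rate_bound i g := forall x, alpha <= x -> x <= alpha + 1 ->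
  f + (e - i)%:~R * hfun c x <= g.
Let digit_map i lo hi k := branch (bad (Tmap N alpha) U) (hfun c) alpha (alpha + 1)
  (fun x => N%:R / x - i%:~R) lo hi k.

Lemma first_branch i g k : 0 <= i -> digit N alpha alpha = i -> cut N alpha i <= alpha + 1 ->
  rate_bound i g -> g ^+ 2 <= k * N%:R -> digit_map i alpha (cut N alpha i) k.
Proof.
move=> i0 di cb Hg gk; have [_ _ Au] := Tmap_alpha di.
apply: (@digit_branch N alpha U e i _ _ g k f c erefl erefl N0 a0 e0 (lexx _) (cut_gt_alpha a0 i0
  di) cb _ Au _ gk).
  by rewrite cut_low.
by move=> x ax xc; apply: Hg => //; exact: le_trans cb.
Qed.

Lemma middle_branch i g k : 0 <= i -> alpha <= cut N alpha (i + 1) ->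
  cut N alpha i <= alpha + 1 -> rate_bound i g -> g ^+ 2 <= k * N%:R ->
  digit_map i (cut N alpha (i + 1)) (cut N alpha i) k.
Proof.
move=> i0 ac cb Hg gk.
apply: (@digit_branch N alpha U e i _ _ g k f c erefl erefl N0 a0 e0 ac (cut_anti N0 a0 i0 _) cb
  _ _ _ gk).
- by rewrite ltrDl.
- by rewrite cut_low.
- by rewrite cut_high.
- by move=> x xc cx; apply: Hg; [exact: le_trans xc | exact: le_trans cb].
Qed.

Lemma last_branch i g k : 0 <= i -> digit N alpha (alpha + 1) = i ->
  alpha <= cut N alpha (i + 1) -> rate_bound i g -> g ^+ 2 <= k * N%:R ->
  digit_map i (cut N alpha (i + 1)) (alpha + 1) k.
Proof.
move=> i0 di ac Hg gk; have [_ Cl _] := Tmap_beta di.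
apply: (@digit_branch N alpha U e i _ _ g k f c erefl erefl N0 a0 e0 ac (cut_lt_end a0 i0 di)
  (lexx _) Cl _ _ gk).
  by rewrite cut_high.
by move=> x cx xb; apply: Hg => //; exact: le_trans cx.
Qed.
End DigitBranches.

End CutPoints.

(** * Contraction rates *)

Section RatioBounds.
Context {R : realFieldType}.
Implicit Types f c t x xi X : R.

(** With its companion [ratio_le], this bounds a coordinate
    [xi = x / (x + c)] by clearing the denominator. *)
Lemma ratio_ge c x t xi : 0 < x + c -> xi * (x + c) = x -> t * c <= (1 - t) * x -> t <= xi.
Proof. by move=> x0 hx ht; rewrite -(ler_pM2r x0) hx; lra. Qed.

Lemma ratio_le c x t xi : 0 < x + c -> xi * (x + c) = x -> (1 - t) * x <= t * c -> xi <= t.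
Proof. by move=> x0 hx ht; rewrite -(ler_pM2r x0) hx; lra. Qed.

Lemma sqB_le f t xi X : t <= xi -> xi <= f -> (f - t) ^+ 2 <= X -> (f - xi) ^+ 2 <= X.
Proof. by move=> ht hx; apply: le_trans; rewrite lerXn2r ?nnegrE; lra. Qed.

Lemma sqD_le f t xi X : 0 <= f -> 0 <= xi -> xi <= t -> (f + t) ^+ 2 <= X -> (f + xi) ^+ 2 <= X.
Proof. by move=> f0 h0 ht; apply: le_trans; rewrite lerXn2r ?nnegrE; lra. Qed.

End RatioBounds.

(** The polynomial inequalities below are about one configuration: [al] is the
    left end of the interval, [f] the fixed point of the branch of digit [e],
    [c = f + e] and [N = f * c], and [a], [b] are the coordinates
    [x / (x + c)] of [al] and [al + 1]. The branches of digits [e + 1], [e],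
    [e - 1], [e - 2] have the rates [(f - a) ^+ 2 / (f * c)], [f / c],
    [(f + b) ^+ 2 / (f * c)] and [(f + 2 * b) ^+ 2 / (f * c)]. Among the
    hypotheses, [al * (c + 1) <= N] says [f <= T al] and
    [f * c <= (al + 1) * (c - 1)] says [T (al + 1) <= f];
    [N < (al + 1) * (al + e)] says that the cut point between the digits [e] and
    [e - 1] lies in the interval, and [(al + 1) * (al + e - 1) <= N],
    [N <= al * (al + e + 2)] that the ends are mapped into it. The decimal
    constants are not sharp. *)
Section Rates.
Context {R : realFieldType}.
Implicit Types N al f e c a b d g k t A B C : R.

(** The hypothesis [al * (c + 1) <= N] bounds [al] from above and
    [N < (al + 1) * (al + e)] bounds it from below; eliminating [al] leaves a
    relation between [f] and [c]. *)
Lemma rates_constraint N al f e c : 0 < f -> 0 < e -> c = f + e -> N = f * c -> 0 < al ->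
  al * (c + 1) <= N -> N < (al + 1) * (al + e) ->
  f ^+ 2 * c + f * (c + 1) ^+ 2 < c * (c + 1) ^+ 2.
Proof.
move=> f0 e0 ce Nf al0 h1 h3.
have c0 : 0 < c by lra.
have k : (c + 1) ^+ 2 * N < (f * c + c + 1) * (f * c + e * (c + 1)).
  apply: lt_le_trans (_ : (c + 1) ^+ 2 * ((al + 1) * (al + e)) <= _).
    by rewrite ltr_pM2l // exprn_gt0 //; lra.
  have -> : (c + 1) ^+ 2 * ((al + 1) * (al + e)) =
     (al * (c + 1) + (c + 1)) * (al * (c + 1) + e * (c + 1)) by ring.
  apply: ler_pM; nra.
rewrite Nf in k; have e_ : e = c - f by lra.
rewrite e_ in k; nra.
Qed.

Lemma fixpt_lt_end N al f e : 0 < f -> 1 <= e -> N = f * (f + e) -> 0 < al ->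
  N < (al + 1) * (al + e) -> f < al + 1.
Proof. move=> *. rewrite ltNge; apply/negP => ?. nra. Qed.

(** The left side of the constraint increases with [f], so it is enough
    to refute it at [f = 66/100 * c], where it fails once [c > 8.8]; otherwise
    [f + 3 <= c] gives the conclusion. *)
Lemma middle_rate_le f c : 0 < f -> f + 3 <= c ->
  f ^+ 2 * c + f * (c + 1) ^+ 2 < c * (c + 1) ^+ 2 -> f <= 66/100 * c.
Proof.
move=> f0 cf G; rewrite leNgt; apply/negP => k.
have c1 : 88/10 < c by lra.
have : (66/100 * c) ^+ 2 * c + (66/100 * c) * (c + 1) ^+ 2 < c * (c + 1) ^+ 2.
  apply: le_lt_trans G; apply: lerD; last by rewrite ler_wpM2r ?sqr_ge0 ?ltW.
  by rewrite ler_wpM2r ?lerXn2r ?nnegrE; lra.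
nra.
Qed.

Lemma end_coord_le al f e c b : 0 < f -> 0 < al -> f + 3 <= c -> c = f + e ->
  al * (c + 1) <= f * c ->
   f <= 66/100 * c -> b * (al + 1 + c) = al + 1 -> b <= 42/100.
Proof.
move=> f0 a0 cf ce h1 fk hb.
have : 29 * (al + 1) <= 21 * c.
  suff : 29 * ((al + 1) * (c + 1)) <= 21 * c * (c + 1) by nra.
  have : 29 * ((al + 1) * (c + 1)) <= 29 * (f * c + c + 1) by nra.
  have [c9|c9] := lerP c 9.
  have : f * c <= (c - 3) * c by nra. nra.
  nra.
nra.
Qed.

Lemma last_rate_le f c b : 15/100 <= f -> f + 3 <= c -> f <= 66/100 * c -> 0 <= b ->
  b <= 42/100 ->
  (f + b) ^+ 2 <= 8/10 * (f * c).
Proof.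
move=> f0 cf fk b0 bb.
have : (f + b)^+2 <= (f + 42/100)^+2 by nra.
have [?|?] := lerP f 5; nra.
Qed.

Lemma fixpt_ge N al f e : 0 < f -> 2 <= e -> N = f * (f + e) -> 0 < al -> al <= f ->
  (al + 1) * (al + e - 1) <= N -> 15/100 <= f.
Proof.
move=> f0 e2 -> a0 af h4; rewrite leNgt; apply/negP => k.
have : f * (f + e) <= 15/100 * (15/100 + e) by apply: ler_pM; lra.
have : 1 * (e-1) <= (al + 1) * (al + e - 1) by apply: ler_pM; lra.
lra.
Qed.

(** When the second iterate of the left end returns to the
    first branch, [al] cannot be large compared with [e]. *)
Lemma return_first_constraint N al e p a1 : 0 < al -> 2 <= e -> 0 < N -> p = N / (al + e + 1) ->
  a1 = N / al - (e + 1) -> al < a1 -> N / a1 - e < p -> N < (al + 1) * (al + e) ->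
  al ^+ 3 + al ^+ 2 < e ^+ 2 * al + e ^+ 3 + 2 * e ^+ 2.
Proof.
move=> a0 e2 N0 hp ha1 a1p hB h3.
have pe : p * (al + e + 1) = N by rewrite hp divfK //; lra.
have a1e : a1 * al = N - (e + 1) * al by rewrite ha1 mulrBl divfK //; lra.
have p0 : 0 < p by rewrite hp divr_gt0 //; lra.
have k : N < a1 * (p + e) by rewrite mulrC -ltr_pdivrMr; [lra|lra].
have k2 : N * al * (al + e + 1) < (N - (e + 1) * al) * (N + e * (al + e + 1)).
  rewrite -a1e; have -> : N + e * (al + e + 1) = (p + e) * (al + e + 1) by rewrite -pe; ring.
  have -> : a1 * al * ((p + e) * (al + e + 1)) = (a1 * (p + e)) * (al * (al + e + 1)) by ring.
  by rewrite -mulrA ltr_pM2r // mulr_gt0 //; lra.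
have k3 : e * (e + 1) * al * (al + e + 1) < N * (N + (e * (al + e + 1) - (e + 1) * al - al * (al
  + e + 1))) by nra.
have k4 : N + (e * (al + e + 1) - (e + 1) * al - al * (al + e + 1)) < e ^+ 2 + 2 * e - al by nra.
have pos : 0 < e * (e + 1) * al * (al + e + 1) by rewrite !mulr_gt0 //; lra.
have Y0 : 0 < e ^+ 2 + 2 * e - al.
  rewrite ltNge; apply/negP => Y. nra.
have : e * (e + 1) * al * (al + e + 1) < ((al + 1) * (al + e)) * (e ^+ 2 + 2 * e - al).
  apply: lt_trans k3 _.
  apply: lt_le_trans (_ : N * (e ^+ 2 + 2 * e - al) <= _).
    by rewrite ltr_pM2l.
  by rewrite ler_wpM2r // ltW.
by move=> ?; nra.
Qed.

(** When the image of the left end reaches the last branch, the gap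
    [f - al] is at least [f * c / ((e + 1) * (f + c))], while [T al <= al + 1]
    bounds it from above. *)
Lemma reach_last_constraint N al f e c : 0 < f -> 0 < al -> 2 <= e -> c = f + e -> N = f * c ->
  al <= f ->
   N / (al + e) <= N / al - (e + 1) -> N <= al * (al + e + 2) ->
   2 * f ^+ 2 + c * f - 2 * f <= c ^+ 2.
Proof.
move=> f0 a0 e2 ce Nf af h5 h2.
have N0 : 0 < N by rewrite Nf mulr_gt0 //; lra.
have k5 : (e + 1) * (al * (al + e)) <= N * e.
  have : 0 <= (N / al - (e + 1) - N / (al + e)) * (al * (al + e)).
    by rewrite mulr_ge0 //; [lra | rewrite mulr_ge0; lra].
  have -> : (N / al - (e + 1) - N / (al + e)) * (al * (al + e)) = N * e - (e + 1) * (al * (al +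
    e)).
    by field; rewrite !lt0r_neq0 //; lra.
  lra.
have [d hd] : exists d, d = f - al by exists (f - al).
have d0 : 0 <= d by lra.
have k1 : f * c <= (e + 1) * (d * (f + c - d)).
  have ha : al = f - d by lra. rewrite ha Nf in k5. rewrite ce in k5 *. nra.
have k2 : d * (f + c - d) + 2 * d <= 2 * f.
  have ha : al = f - d by lra. rewrite ha Nf in h2. rewrite ce in h2 *. nra.
have k3 : 2 * d * (e + 1) <= 2 * f * (e + 1) - f * c by nra.
have k4 : f * c <= (e + 1) * (d * (f + c)) by nra.
have k6 : 2 * (f * c) <= (2 * f * (e + 1) - f * c) * (f + c).
  apply: (le_trans (_ : _ <= 2 * ((e+1) * (d * (f+c))))); first by lra.
  have -> : 2 * ((e+1) * (d * (f+c))) = (2 * d * (e+1)) * (f+c) by ring.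
  by rewrite ler_wpM2r //; lra.
have k7 : 2 * c <= (2 * (e + 1) - c) * (f + c).
  rewrite -(ler_pM2l f0). lra.
have e_ : e = c - f by lra.
by rewrite e_ in k7; nra.
Qed.

Lemma rates_return_first f e c b al : 15/100 <= f -> 3 <= e -> c = f + e -> 0 < al ->
  f < al + 1 -> al <= f ->
  (al + 1) * (al + e) > f * c ->
  al ^+ 3 + al ^+ 2 < e ^+ 2 * al + e ^+ 3 + 2 * e ^+ 2 -> 0 <= b -> b <= 42/100 ->
  f <= 61/100 * c /\ (f + b) ^+ 2 <= 77/100 * (f * c).
Proof.
move=> f0 e3 ce a0 fa af h3 D b0 bb.
have alb : al <= 133/100 * e + 6/100.
  rewrite leNgt; apply/negP => k.
  have : (133/100 * e + 6/100) ^+ 2 <= al ^+ 2 by rewrite lerXn2r ?nnegrE; lra.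
  nra.
have fe : f <= 61/100 * c.
  rewrite leNgt; apply/negP => k.
  have fal : f <= al + 625/1000.
    rewrite leNgt; apply/negP => k'.
    have : (al + 1) * (al + e) <= (f + 375/1000) * (f + e - 625/1000) by apply: ler_pM; lra.
    nra.
  lra.
split=> //.
have : (f + b)^+2 <= (f + 42/100)^+2 by nra.
have [?|?] := lerP f (45/10); nra.
Qed.

Lemma rates_reach_last f e c b : 15/100 <= f -> 3 <= e -> c = f + e ->
  2 * f ^+ 2 + c * f - 2 * f <= c ^+ 2 -> 0 <= b -> b <= 42/100 ->
  f <= 555/1000 * c /\ (f + b) ^+ 2 <= 69/100 * (f * c).
Proof.
move=> f0 e3 ce D b0 bb.
have fe : f <= 555/1000 * c.
  rewrite leNgt; apply/negP => k. nra.
split=> //.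
have : (f + b)^+2 <= (f + 42/100)^+2 by nra.
have [?|?] := lerP f (37/10); nra.
Qed.

Lemma two_product_lt f : 0 < f ->
  f ^+ 2 * (f + 2) + f * (f + 2 + 1) ^+ 2 < (f + 2) * (f + 2 + 1) ^+ 2 -> f * (f + 2) < 25.
Proof.
move=> f0 G; rewrite ltNge; apply/negP => k.
have : 4 < f by nra. nra.
Qed.

(** The product [f * (f + 2)] lies between two products of consecutive
    numbers, the first starting at [f + 1 - t] and the second at [al + 1]. *)
Lemma two_fixpt_near al f t : 0 < f -> 0 < al -> 0 < t -> t < f ->
  (f + 1 - t) * (f + 2 - t) <= f * (f + 2) ->
  f * (f + 2) < (al + 1) * (al + 2) -> f - t <= al.
Proof. move=> f0 a0 t0 tf h1 h3; rewrite leNgt; apply/negP => k. nra. Qed.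

(** This lemma and the next two treat [e = 2], which the estimates for
    [f + 3 <= c] do not cover. A lower bound on [al] near [f] gives one on [a],
    hence an upper bound on the first rate; the available lower bound depends on
    the range of [f]. *)
Lemma two_rates al f a b : 7/10 <= f -> f <= 4 -> 0 < al -> al <= f ->
  al * (f + 3) <= f * (f + 2) ->
  f * (f + 2) < (al + 1) * (al + 2) -> a * (al + (f + 2)) = al ->
  b * (al + 1 + (f + 2)) = al + 1 ->
  (f - a) ^+ 2 <= 56/100 * (f * (f + 2)) /\ (f + b) ^+ 2 <= 82/100 * (f * (f + 2)).
Proof.
move=> f0 f4 a0 af h1 h3 ha hb.
have sa : 0 < al + (f + 2) by lra.
have sb : 0 < al + 1 + (f + 2) by lra.
have af' : a <= f by apply: (ratio_le sa ha); nra.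
have b0 : 0 <= b by apply: (ratio_ge sb hb); lra.
have bv : b <= 425/1000.
  apply: (ratio_le sb hb); clear - f0 a0 af h1 f4.
  have s3 : 0 < f + 3 by lra.
  rewrite -(ler_pM2r s3); nra.
split; last first.
  apply: (sqD_le _ b0 bv); [lra|clear - f0 f4; nra].
have [k|k] := lerP f (254/100).
  apply: (@sqB_le _ _ (0)) => //; [apply: (ratio_ge sa ha); lra|clear - f0 f4 k; nra].
have al1 : f - 7/10 <= al by apply: (two_fixpt_near _ a0 _ _ _ h3); clear - f0 f4 k;
  [lra|lra|lra|nra].
have [k'|k'] := lerP f (337/100).
  apply: (@sqB_le _ _ (2/10)) => //; [apply: (ratio_ge sa ha); lra|clear - f0 f4 k'; nra].
have al2 : f - 6/10 <= al by apply: (two_fixpt_near _ a0 _ _ _ h3); clear - f0 f4 k';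
  [lra|lra|lra|nra].
apply: (@sqB_le _ _ (34/100)) => //; [apply: (ratio_ge sa ha); lra|clear - f0 f4 k'; nra].
Qed.

Lemma two_rates_return_first al f a b : 7/10 <= f -> 0 < al -> al <= f ->
  al * (f + 3) <= f * (f + 2) ->
  al ^+ 3 + al ^+ 2 < 2 ^+ 2 * al + 2 ^+ 3 + 2 * 2 ^+ 2 ->
  f * (f + 2) < (al + 1) * (al + 2) -> a * (al + (f + 2)) = al ->
  b * (al + 1 + (f + 2)) = al + 1 ->
  [/\ f <= 329/100, (f - a) ^+ 2 <= 51/100 * (f * (f + 2)) & (f + b) ^+ 2 <= 795/1000 * (f * (f +
    2))].
Proof.
move=> f0 a0 af h1 D h3 ha hb.
have al27 : al < 27/10 by rewrite ltNge; apply/negP => k; nra.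
have f4 : f <= 329/100 by rewrite leNgt; apply/negP => k; nra.
have sa : 0 < al + (f + 2) by lra.
have sb : 0 < al + 1 + (f + 2) by lra.
have af' : a <= f by apply: (ratio_le sa ha); nra.
have b0 : 0 <= b by apply: (ratio_ge sb hb); lra.
have bv : b <= 42/100.
  apply: (ratio_le sb hb); clear - f0 a0 af h1 f4.
  have s3 : 0 < f + 3 by lra.
  rewrite -(ler_pM2r s3); nra.
split=> //; last first.
  apply: (sqD_le _ b0 bv); [lra|clear - f0 f4; nra].
have [k|k] := lerP f (16/10).
  apply: (@sqB_le _ _ (0)) => //; [apply: (ratio_ge sa ha); lra|clear - f0 f4 k; nra].
have al1 : f - 7/10 <= al by apply: (two_fixpt_near _ a0 _ _ _ h3); clear - f0 f4 k;
  [lra|lra|lra|nra].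
have [k'|k'] := lerP f (26/10).
  apply: (@sqB_le _ _ (2/10)) => //; [apply: (ratio_ge sa ha); lra|clear - f0 f4 k'; nra].
have al2 : f - 62/100 <= al by apply: (two_fixpt_near _ a0 _ _ _ h3); clear - f0 f4 k';
  [lra|lra|lra|nra].
have [k''|k''] := lerP f (317/100).
  apply: (@sqB_le _ _ (3/10)) => //; [apply: (ratio_ge sa ha); lra|clear - f0 f4 k''; nra].
apply: (@sqB_le _ _ (33/100)) => //; [apply: (ratio_ge sa ha); lra|clear - f0 f4 k''; nra].
Qed.

Lemma two_rates_reach_last al f a b : 7/10 <= f -> f * (f + 2) <= 11 -> 0 < al -> al <= f ->
  al * (f + 3) <= f * (f + 2) ->
  f * (f + 2) < (al + 1) * (al + 2) -> a * (al + (f + 2)) = al ->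
  b * (al + 1 + (f + 2)) = al + 1 ->
  [/\ f <= 247/100, (f - a) ^+ 2 <= 44/100 * (f * (f + 2)) & (f + b) ^+ 2 <= 75/100 * (f * (f +
    2))].
Proof.
move=> f0 fc11 a0 af h1 h3 ha hb.
have f4 : f <= 247/100 by rewrite leNgt; apply/negP => k; nra.
have sa : 0 < al + (f + 2) by lra.
have sb : 0 < al + 1 + (f + 2) by lra.
have af' : a <= f by apply: (ratio_le sa ha); nra.
have b0 : 0 <= b by apply: (ratio_ge sb hb); lra.
have bv : b <= 405/1000.
  apply: (ratio_le sb hb); clear - f0 a0 af h1 f4.
  have s3 : 0 < f + 3 by lra.
  rewrite -(ler_pM2r s3); nra.
split=> //; last first.
  apply: (sqD_le _ b0 bv); [lra|clear - f0 f4; nra].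
have [k|k] := lerP f (157/100).
  apply: (@sqB_le _ _ (0)) => //; [apply: (ratio_ge sa ha); lra|clear - f0 f4 k; nra].
have al1 : f - 7/10 <= al by apply: (two_fixpt_near _ a0 _ _ _ h3); clear - f0 f4 k;
  [lra|lra|lra|nra].
have [k'|k'] := lerP f (196/100).
  apply: (@sqB_le _ _ (15/100)) => //; [apply: (ratio_ge sa ha); lra|clear - f0 f4 k'; nra].
have al2 : f - 64/100 <= al by apply: (two_fixpt_near _ a0 _ _ _ h3); clear - f0 f4 k';
  [lra|lra|lra|nra].
have [k''|k''] := lerP f (232/100).
  apply: (@sqB_le _ _ (25/100)) => //; [apply: (ratio_ge sa ha); lra|clear - f0 f4 k''; nra].
apply: (@sqB_le _ _ (28/100)) => //; [apply: (ratio_ge sa ha); lra|clear - f0 f4 k''; nra].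
Qed.

Lemma two_reach_last_lt12 N al f : 0 < f -> 0 < al -> al <= f -> N = f * (f + 2) ->
  N / (al + 2) <= N / al - 3 -> N < (al + 1) * (al + 2) -> N < 12.
Proof.
move=> f0 a0 af Nf h5 h3; rewrite ltNge; apply/negP => k.
have k5 : 3 * (al * (al + 2)) <= N * 2.
  have : 0 <= (N / al - 3 - N / (al + 2)) * (al * (al + 2)).
    by rewrite mulr_ge0 //; [lra | rewrite mulr_ge0; lra].
  have -> : (N / al - 3 - N / (al + 2)) * (al * (al + 2)) = N * 2 - 3 * (al * (al + 2)).
    by field; rewrite !lt0r_neq0 //; lra.
  lra.
have k6 : N / 3 - 2 < al by lra.
nra.
Qed.

(** With [d = f - al], the hypotheses at the two ends bound [d] from
    above by [1 - f / (c - 1)] and from below by [f / (f + c + 1)]; comparing the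
    two gives the quadratic relation [G] between [f] and [c] from which all rates
    follow. *)
Lemma rates_three_right al f e c b : 0 < al -> 0 < f -> al <= f -> f < al + 1 -> 2 <= e ->
  c = f + e -> 2 <= f * c ->
  f * c <= (al + 1) * (c - 1) -> al * (al + e + 1) < f * c -> b * (al + 1 + c) = al + 1 ->
  [/\ f <= 625/1000 * c, (f + b) ^+ 2 <= 77/100 * (f * c) & (f + b) ^+ 2 + f * c < c ^+ 2].
Proof.
move=> a0 f0 af fa e2 ce N2 h1 h2 hb.
have sb : 0 < al + 1 + c by lra.
have G : f ^+ 2 + f * c + f + 1 < c ^+ 2.
  have [d hd] : exists d, d = f - al by exists (f - al).
  have al_ : al = f - d by lra.
  have k1 : f <= (1 - d) * (c - 1) by rewrite al_ in h1; nra.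
  have k2 : f < d * (f + c + 1 - d).
    have e_ : e = c - f by lra.
    by rewrite al_ e_ in h2; nra.
  have k3 : f < d * (f + c + 1) by nra.
  have k4 : f * (c - 1) < d * (f + c + 1) * (c - 1) by rewrite ltr_pM2r //; lra.
  have k5 : d * (c - 1) * (f + c + 1) <= (c - 1 - f) * (f + c + 1) by rewrite ler_wpM2r //; lra.
  clear - k4 k5; lra.
have b0 : 0 <= b by apply: (ratio_ge sb hb); lra.
have b1 : b <= 1/2 by apply: (ratio_le sb hb); lra.
have c1 : 16/10 * f + 55/100 <= c.
  rewrite leNgt; apply/negP => k.
  have : 0 <= (16/10 * f + 55/100 - c) * (16/10 * f + 55/100 + c - f) by apply: mulr_ge0; lra.
  (* 2.625 is the minimum point of the quadratic polynomial in [f] that remains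
     once [c] is replaced by its bound. *)
  have := sqr_ge0 (f - 2625/1000). clear - G; lra.
have b2 : b <= 435/1000.
  apply: (ratio_le sb hb).
  suff : f + 1 <= 769/1000 * c by lra.
  rewrite leNgt; apply/negP => k.
  have : f <= 2 \/ 2 < f by case: (lerP f 2); auto.
  case=> k'; first by lra.
  have k3 : 8/10 < f by lra.
  have [k4|k4] := lerP f (231/100); first by lra.
  clear - G k k4 c1.
  have : 0 <= (13004/10000 * (f + 1) - c) * (13004/10000 * (f + 1) + c - f) by apply: mulr_ge0;
    lra.
  have : 0 <= (f - 231/100) * f by apply: mulr_ge0; lra.
  clear - G k k4; lra.
split; [lra| |clear - G b1 b0 f0; nra].
apply: (sqD_le _ b0 b2); first lra.
clear - f0 ce e2 c1 N2.
have [k|k] := lerP f (1/3); first by nra.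
have [k'|k'] := lerP f (25/10).
  have : f * (f + 2) <= f * c by rewrite ler_pM2l //; lra.
  nra.
have : f * (16/10 * f + 55/100) <= f * c by rewrite ler_pM2l //; lra.
nra.
Qed.

(** As in [rates_three_right], one digit further from the left end. *)
Lemma rates_four_right al f e c b : 0 < al -> 0 < f -> al <= f -> f < al + 1 -> 2 <= e ->
  c = f + e -> 2 <= f * c ->
  f * c <= (al + 1) * (c - 1) -> al * (al + e + 2) < f * c -> b * (al + 1 + c) = al + 1 ->
  f <= 45/100 * c /\ (f + b) ^+ 2 <= 74/100 * (f * c).
Proof.
move=> a0 f0 af fa e2 ce N2 h1 h2 hb.
have sb : 0 < al + 1 + c by lra.
have G : f ^+ 2 + 2 * (f * c) + f < c ^+ 2 + c - 2.
  have [d hd] : exists d, d = f - al by exists (f - al).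
  have al_ : al = f - d by lra.
  have k1 : f <= (1 - d) * (c - 1) by rewrite al_ in h1; nra.
  have k2 : 2 * f < d * (f + c + 2 - d).
    have e_ : e = c - f by lra.
    by rewrite al_ e_ in h2; nra.
  have k3 : 2 * f < d * (f + c + 2) by nra.
  have k4 : 2 * f * (c - 1) < d * (f + c + 2) * (c - 1) by rewrite ltr_pM2r //; lra.
  have k5 : d * (c - 1) * (f + c + 2) <= (c - 1 - f) * (f + c + 2) by rewrite ler_wpM2r //; lra.
  clear - k4 k5; lra.
have b0 : 0 <= b by apply: (ratio_ge sb hb); lra.
have k1 : f <= 45/100 * c.
  rewrite leNgt; apply/negP => k.
  have p1 : 0 <= (f - 45/100 * c) * c by apply: mulr_ge0; lra.
  have p2 : 0 <= (f - 45/100 * c) * f by apply: mulr_ge0; lra.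
  (* 2.75 is close to the minimum point of the quadratic polynomial in [c] that
     remains once [f] is replaced by its bound. *)
  have := sqr_ge0 c; have := sqr_ge0 (c - 275/100). clear - G p1 p2 k; lra.
have b2 : b <= 43/100.
  by apply: (ratio_le sb hb); have [k|k] := lerP f 2; lra.
split=> //.
apply: (sqD_le _ b0 b2); first lra.
clear - f0 ce e2 k1 N2.
have [k|k] := lerP f (4/10); first by nra.
have [k'|k'] := lerP f (19/10).
  have : f * (f + 2) <= f * c by rewrite ler_pM2l //; lra.
  nra.
have : f * (222/100 * f) <= f * c by rewrite ler_pM2l //; lra.
nra.
Qed.

(** As in [rates_constraint], with the last cut point one digit lower. *)
Lemma rates_four_left al f e c b : 0 < al -> 0 < f -> al <= f -> 3 <= e -> c = f + e ->
  2 <= f * c ->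
  al * (c + 1) <= f * c -> f * c < (al + 1) * (al + e - 1) -> b * (al + 1 + c) = al + 1 ->
  [/\ f <= 415/1000 * c, (f + b) ^+ 2 <= 56/100 * (f * c) & (f + 2 * b) ^+ 2 <= 76/100 * (f * c)].
Proof.
move=> a0 f0 af e3 ce N2 h1 h3 hb.
have sb : 0 < al + 1 + c by lra.
have c0 : 0 < c by lra.
have G : f ^+ 2 * c + f * ((2 * c + 1) * (c + 1)) < (c + 1) ^+ 2 * (c - 1).
  have k : (c + 1) ^+ 2 * (f * c) < (f * c + c + 1) * (f * c + (e - 1) * (c + 1)).
    apply: lt_le_trans (_ : (c + 1) ^+ 2 * ((al + 1) * (al + e - 1)) <= _).
      by rewrite ltr_pM2l // exprn_gt0 //; lra.
    have -> : (c + 1) ^+ 2 * ((al + 1) * (al + e - 1)) =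
       (al * (c + 1) + (c + 1)) * (al * (c + 1) + (e - 1) * (c + 1)) by ring.
    apply: ler_pM; nra.
  have e_ : e = c - f by lra.
  rewrite e_ in k; nra.
have b0 : 0 <= b by apply: (ratio_ge sb hb); lra.
have k1 : f <= 415/1000 * c.
  rewrite leNgt; apply/negP => k. clear - f0 G k c0.
  have : (415/1000 * c) ^+ 2 * c + (415/1000 * c) * ((2 * c + 1) * (c + 1)) < (c + 1) ^+ 2 * (c -
    1).
    apply: le_lt_trans G; apply: lerD.
      by rewrite ler_wpM2r ?lerXn2r ?nnegrE; lra.
    by rewrite ler_wpM2r ?mulr_ge0; lra.
  nra.
have s1 : 0 < c + 1 by lra.
have be : (al + 1) * (c + 1) <= f * c + c + 1 by nra.
have b2 : b <= 36/100.
  apply: (ratio_le sb hb); rewrite -(ler_pM2r s1).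
  apply: (@le_trans _ _ (64/100 * (f * c + c + 1))); first lra.
  have [k|k] := lerP c 5; clear - k ce e3 k1 f0; last by nra.
  have : f * c <= (c - 3) * c by nra. nra.
split=> //.
  apply: (sqD_le _ b0 b2); first lra.
  have [k|k] := lerP f 2.
    have : f * (f + 3) <= f * c by rewrite ler_pM2l //; lra. clear - k f0 N2; nra.
  have c3 : 241/100 * f + 2/10 <= c.
    rewrite leNgt; apply/negP => k'. clear - G k' k c0 e3 ce f0.
    have y0 : 0 <= (c - 2/10) * (100/241) by lra.
    have : ((c - 2/10) * (100/241)) ^+ 2 * c + (c - 2/10) * (100/241) * ((2 * c + 1) * (c + 1)) <
      (c + 1) ^+ 2 * (c - 1).
      apply: le_lt_trans G; apply: lerD.
        by rewrite ler_wpM2r ?lerXn2r ?nnegrE; lra.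
      by rewrite ler_wpM2r ?mulr_ge0; lra.
    have : 0 <= c ^+ 3 by rewrite exprn_ge0 // ltW.
    have := sqr_ge0 c; clear - c0; lra.
  have : f * (241/100 * f + 2/10) <= f * c by rewrite ler_pM2l //; lra. clear - k; nra.
have b20 : 0 <= 2 * b by lra.
have [k|k] := lerP f (8/10).
  have b3 : 2 * b <= 63/100.
    suff : b <= 315/1000 by lra.
    apply: (ratio_le sb hb); rewrite -(ler_pM2r s1).
    apply: (@le_trans _ _ (685/1000 * (f * c + c + 1))); first lra.
    clear - k f0 ce e3. nra.
  apply: (sqD_le _ b20 b3); first lra.
  have [k'|k'] := lerP f (6/10); first by clear - k' f0 N2; nra.
  have : f * (f + 3) <= f * c by rewrite ler_pM2l //; lra. clear - k k'; nra.
have b3 : 2 * b <= 72/100 by lra.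
apply: (sqD_le _ b20 b3); first lra.
have [k'|k'] := lerP f (26/10).
  have : f * (f + 3) <= f * c by rewrite ler_pM2l //; lra. clear - k k'; nra.
have : f * (24/10 * f) <= f * c by rewrite ler_pM2l //; lra. clear - k k'; nra.
Qed.

Lemma ler_pM_exp a b A B n : 0 <= a -> 0 <= b -> a <= A -> b <= B -> a * b ^+ n <= A * B ^+ n.
Proof. by move=> *; apply: ler_pM => //; [exact: exprn_ge0|rewrite lerXn2r ?nnegrE // (le_trans _
  (_ : b <= _))]. Qed.

(** All conditions are monotone in the rates, so that it is enough to
    check them at decimal upper bounds. *)
Lemma contracting3W a b c A B C : 0 <= a -> 0 <= b -> 0 <= c -> a <= A -> b <= B -> c <= C ->
  contracting3 A B C -> contracting3 a b c.
Proof.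
move=> a0 b0 c0 aA bB cC [h1 h2 h3 h6].
have A0 := le_trans a0 aA; have B0 := le_trans b0 bB; have C0 := le_trans c0 cC.
have a2 : a ^+ 2 <= A ^+ 2 by rewrite lerXn2r.
have c2 : c ^+ 2 <= C ^+ 2 by rewrite lerXn2r.
split.
- by apply: le_lt_trans h1; apply: lerD => //; apply: ler_pM.
- by apply: le_lt_trans h2; apply: lerD => //; apply: ler_pM_exp.
- by apply: le_lt_trans h3; apply: lerD => //; apply: ler_pM_exp.
- by apply: le_trans h6; apply: lerD => //; apply: ler_pM => //; apply: exprn_ge0.
Qed.

Lemma rate_powW a b c A B C n : 0 <= a -> 0 <= b -> a <= A -> b <= B -> c <= C ->
  A * B ^+ n + C < 1 -> a * b ^+ n + c < 1.
Proof. by move=> a0 b0 aA bB cC; apply: le_lt_trans; apply: lerD => //; apply: ler_pM_exp. Qed.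

(** For [e >= 3] the bounds are uniform. For [e = 2] they hold only
    because [N] is an integer: [2 <= N] bounds [f] from below, and [N < 25],
    [N < 12] become [N <= 24], [N <= 11]. *)
Lemma rates_three_left (n : nat) N al f e c a b : 0 < al -> 0 < f -> N = n%:R -> c = f + e ->
  N = f * c -> al <= f ->
  (e = 2 \/ 3 <= e) -> al * (c + 1) <= N -> N < (al + 1) * (al + e) ->
  (al + 1) * (al + e - 1) <= N ->
  N <= al * (al + e + 2) -> al < N / al - (e + 1) ->
  a * (al + c) = al -> b * (al + 1 + c) = al + 1 ->
  let At := (f - a) ^+ 2 / (f * c) in let B := f / c in let C := (f + b) ^+ 2 / (f * c) in
  [/\ contracting3 At B C,
     (N / (N / al - (e + 1)) - e < N / (al + e + 1) -> At * B ^+ 2 + C < 1),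
     (N / (al + e) <= N / al - (e + 1) -> At * B + C < 1) & At < 1].
Proof.
move=> a0 f0 Nn ce Nf af e23 h1 h3 h4 h2 a1p ha hb At B C.
have e2 : 2 <= e by lra.
have c0 : 0 < c by lra.
have fc0 : 0 < f * c by rewrite mulr_gt0.
have N0 : 0 < N by rewrite Nf.
have sa : 0 < al + c by lra.
have sb : 0 < al + 1 + c by lra.
have av : 0 <= a by apply: (ratio_ge sa ha); lra.
have b0 : 0 <= b by apply: (ratio_ge sb hb); lra.
have af' : a <= f.
  by apply: (ratio_le sa ha); nra.
have At0 : 0 <= At by rewrite divr_ge0 ?sqr_ge0 // ltW.
have B0 : 0 <= B by rewrite divr_ge0 // ltW.
have C0 : 0 <= C by rewrite divr_ge0 ?sqr_ge0 // ltW.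
have Ale t : (f - a) ^+ 2 <= t * (f * c) -> At <= t by rewrite ler_pdivrMr.
have Cle t : (f + b) ^+ 2 <= t * (f * c) -> C <= t by rewrite ler_pdivrMr.
have Ble t : f <= t * c -> B <= t by rewrite ler_pdivrMr.
have fa : f < al + 1 by apply: fixpt_lt_end h3; rewrite ?Nf ?ce //; lra.
have G := rates_constraint f0 (lt_le_trans (ltr0Sn _ 1) e2) ce Nf a0 h1 h3.
case: e23 => [e_|e3]; last first.
  have cf : f + 3 <= c by lra.
  have f15 : 15/100 <= f by apply: (fixpt_ge f0 e2 _ a0 af h4); rewrite Nf ce.
  have k66 := middle_rate_le f0 cf G.
  have b42 : b <= 42/100 by apply: (end_coord_le f0 a0 cf ce _ k66 hb); rewrite -Nf.
  have AB : At <= B.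
    apply: Ale; have -> : B * (f * c) = f ^+ 2 by rewrite /B; field; rewrite lt0r_neq0.
    by rewrite lerXn2r ?nnegrE; clear - av af' f0; lra.
  have B1 := Ble _ k66.
  have C1 := Cle _ (last_rate_le f15 cf k66 b0 b42).
  split.
  - by apply: (contracting3W At0 B0 C0 (le_trans AB B1) B1 C1); clear - a0; split; lra.
  - move=> hB; have D := return_first_constraint a0 e2 N0 erefl erefl a1p hB h3.
    have h3' : (al + 1) * (al + e) > f * c by rewrite -Nf.
    have [fk gk] := rates_return_first f15 e3 ce a0 fa af h3' D b0 b42.
    by apply: (rate_powW At0 B0 (le_trans AB (Ble _ fk)) (Ble _ fk) (Cle _ gk)); clear - a0; lra.
  - move=> h5; have D := reach_last_constraint f0 a0 e2 ce Nf af h5 h2.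
    have [fk gk] := rates_reach_last f15 e3 ce D b0 b42.
    have := rate_powW At0 B0 (le_trans AB (Ble _ fk)) (Ble _ fk) (Cle _ gk) (n := 1).
    by rewrite !expr1; apply; clear - a0; lra.
  - by move: AB B1; clear; lra.
have c_ : c = f + 2 by lra.
have Nf2 : N = f * (f + 2) by rewrite Nf c_.
have h1' : al * (f + 3) <= f * (f + 2) by rewrite -Nf2 (_ : f + 3 = c + 1) //; lra.
have h3' : f * (f + 2) < (al + 1) * (al + 2) by rewrite -Nf2 -e_.
have ha' : a * (al + (f + 2)) = al by rewrite -c_.
have hb' : b * (al + 1 + (f + 2)) = al + 1 by rewrite -c_.
have fcE : f * (f + 2) = f * c by rewrite c_.
have f7 : 7/10 <= f.
  have n2 : 2 <= N.
    rewrite Nn ler_nat ltnNge; apply/negP => n1; move: h4; rewrite Nn leNgt e_ => /negP; apply.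
    by apply: le_lt_trans (_ : 1 < _); [rewrite -(ler_nat R) in n1 | nra].
  by rewrite leNgt; apply/negP => k; nra.
have f4 : f <= 4.
  have : N < 25 by rewrite Nf2; apply: two_product_lt => //; rewrite -c_.
  rewrite Nn ltr_nat ltnS -(ler_nat R) -Nn Nf2 => k.
  by rewrite leNgt; apply/negP => k'; nra.
have [ga gb] := two_rates f7 f4 a0 af h1' h3' ha' hb'.
rewrite fcE in ga gb.
have B1 : B <= 2/3 by apply: Ble; clear - f4 c_; lra.
split.
- by apply: (contracting3W At0 B0 C0 (Ale _ ga) B1 (Cle _ gb)); clear - a0; split; lra.
- move=> hB; have D := return_first_constraint a0 e2 N0 erefl erefl a1p hB h3.
  rewrite e_ in D.
  have [fk gk gk'] := two_rates_return_first f7 a0 af h1' D h3' ha' hb'.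
  rewrite fcE in gk gk'.
  have B2 : B <= 622/1000 by apply: Ble; clear - fk c_; lra.
  by apply: (rate_powW At0 B0 (Ale _ gk) B2 (Cle _ gk')); clear - a0; lra.
- rewrite {1}e_ => h5.
  have : N < 12.
    apply: (two_reach_last_lt12 f0 a0 af Nf2); last by rewrite -e_.
    by rewrite e_ in h5; move: h5; rewrite (_ : 2 + 1 = 3) //; ring.
  rewrite Nn ltr_nat ltnS -(ler_nat R) -Nn Nf2 => k.
  have [fk gk gk'] := two_rates_reach_last f7 k a0 af h1' h3' ha' hb'.
  rewrite fcE in gk gk'.
  have B2 : B <= 553/1000 by apply: Ble; clear - fk c_; lra.
  have := rate_powW At0 B0 (Ale _ gk) B2 (Cle _ gk') (n := 1).
  by rewrite !expr1; apply; clear - a0; lra.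
- by have := Ale _ ga; clear; lra.
Qed.

End Rates.

(** * A bad interval makes the whole interval bad *)

Section Spreading.
Context {R : realType}.
Implicit Types (N : nat) (alpha : R) (e i d : int) (U : set R).

(** This and [ger_cross] turn conditions on the values of branches at the
    ends into polynomial inequalities. *)
Lemma ler_cross (n x y i : R) : 0 < x -> y <= n / x - i -> (y + i) * x <= n.
Proof. by move=> x0 h; rewrite -ler_pdivlMr // -lerBrDr. Qed.

Lemma ger_cross (n x y i : R) : 0 < x -> n / x - i <= y -> n <= (y + i) * x.
Proof. by move=> x0 h; rewrite -ler_pdivrMr // -lerBlDr. Qed.

(** The rates are kept as exact quotients because
    [rates_three_left] bounds them differently according to the position of
    [T alpha] and of its image. *)
Lemma three_digits_left N alpha U e x y : (2 <= N)%N -> 0 < alpha -> 2 <= e ->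
  digit N alpha alpha = e + 1 -> digit N alpha (alpha + 1) = e - 1 ->
  fixpt N e <= Tmap N alpha alpha ->
  alpha <= x -> x < y -> y <= alpha + 1 -> bad (Tmap N alpha) U x y ->
  bad (Tmap N alpha) U alpha (alpha + 1).
Proof.
move=> N2 a0 e2 dal dbe hT ax xy yb bxy.
have N0 : (0 < N)%N by apply: leq_trans N2.
have e1 : 1 <= e by apply: le_trans e2.
have e0 : 0 <= e by apply: le_trans e1.
have i0 : 0 <= e + 1 by rewrite addr_ge0.
have j0 : 0 <= e - 1 by rewrite subr_ge0.
have alp := cut_gt_alpha a0 i0 dal.
have qbe := cut_lt_end a0 j0 dbe; rewrite subrK in qbe.
have pq : cut N alpha (e + 1) < cut N alpha e by apply: cut_anti => //; rewrite ltrDl.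
have pbe := ltW (lt_trans pq qbe); have alq := ltW (lt_trans alp pq).
have /andP[pf fq] := fixpt_cut N0 a0 e1 alp qbe.
have [f0 fN] := fixptP (R := R) e N0.
have f_fix : N%:R / fixpt N e - e%:~R = fixpt N e :> R.
  by rewrite -fN; field; rewrite lt0r_neq0.
have c0 : 0 < fixpt N e + e%:~R :> R by rewrite ltr_wpDr // ler0z.
have N_gt0 : 0 < N%:R :> R by rewrite ltr0n.
have sqK (g : R) : g ^+ 2 <= g ^+ 2 / (fixpt N e * (fixpt N e + e%:~R)) * N%:R.
  by rewrite fN divfK // lt0r_neq0.
have brA := first_branch U N0 a0 e0 i0 dal pbe
  (rate_first e (fixpt N e) c0 a0 (be := alpha + 1)) (sqK _).
have kB : fixpt N e ^+ 2 <= fixpt N e / (fixpt N e + e%:~R) * N%:R :> R.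
  by rewrite -fN mulrA mulrAC mulrVK ?unitfE ?lt0r_neq0 // expr2.
have brB := middle_branch U N0 a0 e0 e0 (ltW alp) (ltW qbe)
  (fun x ax _ => rate_low (fixpt N e) (lexx e) c0 a0 ax) kB.
have ee1 : e - (e - 1) = 1 by rewrite opprB addrCA subrr addr0.
have le1 : e - 1 <= e by rewrite gerBl.
have brC := last_branch U N0 a0 e0 j0 dbe.
rewrite subrK in brC.
have {}brC := brC _ _ alq (rate_high (fixpt N e) le1 c0 a0 (be := alpha + 1)) (sqK _).
rewrite ee1 mul1r in brC.
have A_p := cut_low N0 a0 i0; have B_p := cut_high N0 a0 e0.
have B_q := cut_low N0 a0 e0.
have C_q : N%:R / cut N alpha e - (e - 1)%:~R = alpha + 1.
  by have := cut_high N0 a0 j0; rewrite subrK.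
have [Ta Al Au] := Tmap_alpha dal; have [Tb Cl Cu] := Tmap_beta dbe.
have ha := hfunK (addr_gt0 a0 c0).
have hb := hfunK (addr_gt0 (addr_gt0 a0 ltr01) c0).
have e23 : e%:~R = 2 :> R \/ 3 <= e%:~R :> R.
  move: e2; rewrite le_eqVlt => /predU1P[<-|e3]; [by left|right].
  by rewrite (_ : 3 = 3%:~R) // ler_int -lez1D in e3 *.
rewrite Ta in hT.
have E1 : (e + 1)%:~R = e%:~R + 1 :> R by rewrite intrD.
have E2 : (e - 1)%:~R = e%:~R - 1 :> R by rewrite intrB.
have al_f : alpha <= fixpt N e := ltW (lt_trans alp pf).
have h1 : alpha * (fixpt N e + e%:~R + 1) <= N%:R.
  by have := ler_cross a0 hT; rewrite E1 mulrC addrA.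
have h2 : N%:R < (alpha + 1) * (alpha + e%:~R).
  by move: qbe; rewrite ltr_pdivrMr // cut_den_gt0.
have h3 : (alpha + 1) * (alpha + e%:~R - 1) <= N%:R.
  by have := ler_cross (addr_gt0 a0 ltr01) Cl; rewrite E2 mulrC addrA.
have h4 : N%:R <= alpha * (alpha + e%:~R + 2).
  have -> : alpha * (alpha + e%:~R + 2) = (alpha + 1 + (e + 1)%:~R) * alpha by rewrite E1; ring.
  exact: ger_cross a0 Au.
have h5 := Al; rewrite E1 in h5.
have [] := @rates_three_left R N N%:R alpha (fixpt N e) e%:~R (fixpt N e + e%:~R) _ _ a0 f0 erefl
  erefl (esym fN) al_f e23 h1 h2 h3 h4 h5 ha hb.
rewrite -E1 => w3 w4 w5 At1.
have rB : fixpt N e / (fixpt N e + e%:~R) < 1 :> R.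
  by rewrite ltr_pdivrMr // mul1r ltrDl ltr0z.
have denf : 0 < fixpt N e * (fixpt N e + e%:~R) :> R by rewrite fN.
apply: (three_branch (bad_familyP _ _) (hfun_mono c0 a0 (be := alpha + 1)) alp pf fq qbe
  (divr_ge0 (sqr_ge0 _) (ltW denf)) (divr_gt0 f0 c0) (divr_ge0 (sqr_ge0 _) (ltW denf))
  At1 rB brA brB brC A_p B_p B_q C_q f_fix hT w3 _ w5 ax xy yb bxy).
by move=> H; apply: w4; move: H; rewrite /cut E1 addrA.
Qed.

(** The mirror image exchanges the first and the last rate.
    The product of the middle and last rates needs the exact
    inequality of [rates_three_right]; decimal bounds are too coarse for it. *)
Lemma three_digits_right N alpha U e x y : (2 <= N)%N -> 0 < alpha -> 2 <= e ->
  digit N alpha alpha = e + 1 -> digit N alpha (alpha + 1) = e - 1 ->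
  Tmap N alpha (alpha + 1) <= fixpt N e ->
  alpha <= x -> x < y -> y <= alpha + 1 -> bad (Tmap N alpha) U x y ->
  bad (Tmap N alpha) U alpha (alpha + 1).
Proof.
move=> N2 a0 e2 dal dbe hT ax xy yb bxy.
have N0 : (0 < N)%N by apply: leq_trans N2.
have e1 : 1 <= e by apply: le_trans e2.
have e0 : 0 <= e by apply: le_trans e1.
have i0 : 0 <= e + 1 by rewrite addr_ge0.
have j0 : 0 <= e - 1 by rewrite subr_ge0.
have alp := cut_gt_alpha a0 i0 dal.
have qbe := cut_lt_end a0 j0 dbe; rewrite subrK in qbe.
have pq : cut N alpha (e + 1) < cut N alpha e by apply: cut_anti => //; rewrite ltrDl.
have pbe := ltW (lt_trans pq qbe); have alq := ltW (lt_trans alp pq).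
have /andP[pf fq] := fixpt_cut N0 a0 e1 alp qbe.
have [f0 fN] := fixptP (R := R) e N0.
have f_fix : N%:R / fixpt N e - e%:~R = fixpt N e :> R.
  by rewrite -fN; field; rewrite lt0r_neq0.
have c0 : 0 < fixpt N e + e%:~R :> R by rewrite ltr_wpDr // ler0z.
have N_gt0 : 0 < N%:R :> R by rewrite ltr0n.
have [Ta Al Au] := Tmap_alpha dal; have [Tb Cl Cu] := Tmap_beta dbe.
have ha := hfunK (addr_gt0 a0 c0).
have hb := hfunK (addr_gt0 (addr_gt0 a0 ltr01) c0).
have al_f : alpha <= fixpt N e := ltW (lt_trans alp pf).
have f_be : fixpt N e < alpha + 1 := lt_trans fq qbe.
have E1 : (e + 1)%:~R = e%:~R + 1 :> R by rewrite intrD.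
have E2 : (e - 1)%:~R = e%:~R - 1 :> R by rewrite intrB.
have e2' : 2 <= e%:~R :> R by rewrite (_ : 2 = 2%:~R) // ler_int.
rewrite Tb in hT.
have h0 : 2 <= fixpt N e * (fixpt N e + e%:~R) :> R by rewrite fN ler_nat.
have h1 : fixpt N e * (fixpt N e + e%:~R) <= (alpha + 1) * (fixpt N e + e%:~R - 1).
  by have := ger_cross (addr_gt0 a0 ltr01) hT; rewrite fN E2 mulrC addrA.
have h2 : alpha * (alpha + e%:~R + 1) < fixpt N e * (fixpt N e + e%:~R).
  by move: alp; rewrite fN /cut E1 addrA ltr_pdivlMr // -addrA -E1 cut_den_gt0.
have [fk gk fcc] := @rates_three_right R alpha (fixpt N e) e%:~R _ _ a0 f0 al_f f_be e2' erefl h0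
  h1 h2 hb.
have kB : fixpt N e ^+ 2 <= fixpt N e / (fixpt N e + e%:~R) * N%:R :> R.
  by rewrite -fN mulrA mulrAC mulrVK ?unitfE ?lt0r_neq0 // expr2.
have denf : 0 < fixpt N e * (fixpt N e + e%:~R) :> R by rewrite fN.
have sqK (g : R) : g ^+ 2 <= g ^+ 2 / (fixpt N e * (fixpt N e + e%:~R)) * N%:R.
  by rewrite fN divfK // lt0r_neq0.
have ee1 : e - (e - 1) = 1 by rewrite opprB addrCA subrr addr0.
have le1 : e - 1 <= e by rewrite gerBl.
have le2 : e <= e + 1 by rewrite lerDl.
have brA := first_branch U N0 a0 e0 i0 dal pbe
  (fun x ax _ => rate_low (fixpt N e) le2 c0 a0 ax) kB.
have brB := middle_branch U N0 a0 e0 e0 (ltW alp) (ltW qbe)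
  (fun x ax _ => rate_low (fixpt N e) (lexx e) c0 a0 ax) kB.
have brC := last_branch U N0 a0 e0 j0 dbe.
rewrite subrK in brC.
have {}brC := brC _ _ alq (rate_high (fixpt N e) le1 c0 a0 (be := alpha + 1)) (sqK _).
rewrite ee1 mul1r in brC.
have A_p := cut_low N0 a0 i0; have B_p := cut_high N0 a0 e0.
have B_q := cut_low N0 a0 e0.
have C_q : N%:R / cut N alpha e - (e - 1)%:~R = alpha + 1.
  by have := cut_high N0 a0 j0; rewrite subrK.
move: (hfun _ (alpha + 1)) gk fcc brC => b gk fcc brC.
have [k kE] : exists k, k = fixpt N e / (fixpt N e + e%:~R) :> R by eexists.
have [C CE] : exists C, C = (fixpt N e + b) ^+ 2 / (fixpt N e * (fixpt N e + e%:~R)) by eexists.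
have k0 : 0 < k by rewrite kE divr_gt0.
have C0 : 0 <= C by rewrite CE divr_ge0 ?sqr_ge0 // ltW.
have kle : k <= 625/1000 by rewrite kE ler_pdivrMr.
have Cle : C <= 77/100 by rewrite CE ler_pdivrMr.
have kC : C * k + k < 1.
  have -> : C * k + k = ((fixpt N e + b) ^+ 2 + fixpt N e * (fixpt N e + e%:~R)) / (fixpt N e +
    e%:~R) ^+ 2.
    by rewrite CE kE; clear - f0 c0; field; rewrite !lt0r_neq0.
  by rewrite ltr_pdivrMr ?exprn_gt0 // mul1r.
rewrite -kE in brA brB; rewrite -CE in brC.
have k1 : k < 1 by clear - kle; lra.
have C1 : C < 1 by clear - Cle; lra.
have kk : C * k ^+ 2 <= C * k by rewrite ler_wpM2l // expr2 ger_pMl // ltW.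
have kk3 : C * k ^+ 3 <= C * k ^+ 2 by rewrite ler_wpM2l // [k ^+ 3]exprS ger_pMl ?exprn_gt0 //
  ltW.
have k2 : k ^+ 2 <= k by rewrite expr2 ger_pMl // ltW.
have C2 : C ^+ 2 <= 77/100 * (77/100) by rewrite expr2; apply: ler_pM.
have k22 : k * k <= 625/1000 * (625/1000) by apply: ler_pM => //; exact: ltW.
have CC : C ^+ 2 * k <= C * k by rewrite ler_wpM2r ?(ltW k0) // expr2 ler_piMl // ltW.
apply: (three_branch_mirror (bad_familyP _ _) (hfun_mono c0 a0 (be := alpha + 1)) alp pf fq qbe
  (ltW k0) k0 C0 k1 C1 brA brB brC A_p B_p B_q C_q f_fix hT _ _ kC ax xy yb bxy);
  clear - kk kk3 k2 C2 k22 CC kC; first split; lra.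
Qed.

Lemma four_digits_left N alpha U e x y : (2 <= N)%N -> 0 < alpha -> 3 <= e ->
  digit N alpha alpha = e + 1 -> digit N alpha (alpha + 1) = e - 2 ->
  fixpt N e <= Tmap N alpha alpha ->
  alpha <= x -> x < y -> y <= alpha + 1 -> bad (Tmap N alpha) U x y ->
  bad (Tmap N alpha) U alpha (alpha + 1).
Proof.
move=> N2 a0 e3 dal dbe hT ax xy yb bxy.
have N0 : (0 < N)%N by apply: leq_trans N2.
have e2 : 2 <= e by apply: le_trans e3.
have e1 : 1 <= e by apply: le_trans e2.
have e0 : 0 <= e by apply: le_trans e1.
have i0 : 0 <= e + 1 by rewrite addr_ge0.
have j0 : 0 <= e - 2 by rewrite subr_ge0.
have j1 : 0 <= e - 1 by rewrite subr_ge0.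
have ee : e - 2 + 1 = e - 1 by ring.
have alp := cut_gt_alpha a0 i0 dal.
have rbe := cut_lt_end a0 j0 dbe; rewrite ee in rbe.
have pq : cut N alpha (e + 1) < cut N alpha e by apply: cut_anti => //; rewrite ltrDl.
have qr : cut N alpha e < cut N alpha (e - 1) by apply: cut_anti => //; rewrite gtrBl.
have qbe := lt_trans qr rbe; have pbe := lt_trans pq qbe.
have alq := lt_trans alp pq; have alr := lt_trans alq qr.
have /andP[pf fq] := fixpt_cut N0 a0 e1 alp qbe.
have [f0 fN] := fixptP (R := R) e N0.
have f_fix : N%:R / fixpt N e - e%:~R = fixpt N e :> R.
  by rewrite -fN; field; rewrite lt0r_neq0.
have c0 : 0 < fixpt N e + e%:~R :> R by rewrite ltr_wpDr // ler0z.
have N_gt0 : 0 < N%:R :> R by rewrite ltr0n.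
have [Ta Al Au] := Tmap_alpha dal; have [Tb Cl Cu] := Tmap_beta dbe.
have ha := hfunK (addr_gt0 a0 c0).
have hb := hfunK (addr_gt0 (addr_gt0 a0 ltr01) c0).
have al_f : alpha <= fixpt N e := ltW (lt_trans alp pf).
have E1 : (e + 1)%:~R = e%:~R + 1 :> R by rewrite intrD.
have E2 : (e - 1)%:~R = e%:~R - 1 :> R by rewrite intrB.
have e3' : 3 <= e%:~R :> R by rewrite (_ : 3 = 3%:~R) // ler_int.
rewrite Ta in hT.
have h0 : 2 <= fixpt N e * (fixpt N e + e%:~R) :> R by rewrite fN ler_nat.
have h1 : alpha * (fixpt N e + e%:~R + 1) <= fixpt N e * (fixpt N e + e%:~R).
  by have := ler_cross a0 hT; rewrite fN E1 mulrC addrA.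
have h2 : fixpt N e * (fixpt N e + e%:~R) < (alpha + 1) * (alpha + e%:~R - 1).
  by move: rbe; rewrite fN /cut E2 addrA ltr_pdivrMr // -addrA -E2 cut_den_gt0.
have [fk gk hk] := @rates_four_left R alpha (fixpt N e) e%:~R _ _ a0 f0 al_f e3' erefl h0 h1 h2
  hb.
have kB : fixpt N e ^+ 2 <= 415 / 1000 * N%:R :> R.
  by rewrite -fN expr2 [leRHS]mulrCA; apply: ler_wpM2l (ltW f0) _ _ _.
rewrite fN in gk hk.
have ee1 : e - (e - 1) = 1 by ring.
have ee2 : e - (e - 2) = 2 by ring.
have le0 : e <= e + 1 by rewrite lerDl.
have le1 : e - 1 <= e by rewrite gerBl.
have le2 : e - 2 <= e by rewrite gerBl.
have brA := first_branch U N0 a0 e0 i0 dal (ltW pbe)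
  (fun x ax _ => rate_low (fixpt N e) le0 c0 a0 ax) kB.
have brB := middle_branch U N0 a0 e0 e0 (ltW alp) (ltW qbe)
  (fun x ax _ => rate_low (fixpt N e) (lexx e) c0 a0 ax) kB.
have gC : forall x, alpha <= x -> x <= alpha + 1 -> fixpt N e + (e - (e - 1))%:~R *
    hfun (fixpt N e + e%:~R) x <= fixpt N e + hfun (fixpt N e + e%:~R) (alpha + 1).
  by move=> t t1 t2; have := rate_high (fixpt N e) le1 c0 a0 t1 t2; rewrite ee1 !mul1r.
have gD : forall x, alpha <= x -> x <= alpha + 1 -> fixpt N e + (e - (e - 2))%:~R *
    hfun (fixpt N e + e%:~R) x <= fixpt N e + 2 * hfun (fixpt N e + e%:~R) (alpha + 1).
  by move=> t t1 t2; have := rate_high (fixpt N e) le2 c0 a0 t1 t2; rewrite ee2.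
have brC := middle_branch U N0 a0 e0 j1; rewrite subrK in brC.
have {}brC := brC _ _ (ltW alq) (ltW rbe) gC gk.
have brD := last_branch U N0 a0 e0 j0 dbe; rewrite ee in brD.
have {}brD := brD _ _ (ltW alr) gD hk.
have A_p := cut_low N0 a0 i0; have B_p := cut_high N0 a0 e0.
have B_q := cut_low N0 a0 e0; have C_r := cut_low N0 a0 j1.
have C_q : N%:R / cut N alpha e - (e - 1)%:~R = alpha + 1.
  by have := cut_high N0 a0 j1; rewrite subrK.
have D_r : N%:R / cut N alpha (e - 1) - (e - 2)%:~R = alpha + 1.
  by have := cut_high N0 a0 j0; rewrite ee.
apply: (four_branch (bad_familyP _ _) (hfun_mono c0 a0 (be := alpha + 1)) alp pf fq qr rbe
  _ _ _ _ _ _ _ _ brA brB brC brD A_p B_p B_q C_q C_r D_r f_fix hT _ _ _ ax xy yb bxy);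
  clear; lra.
Qed.

Lemma four_digits_right N alpha U e x y : (2 <= N)%N -> 0 < alpha -> 2 <= e ->
  digit N alpha alpha = e + 2 -> digit N alpha (alpha + 1) = e - 1 ->
  Tmap N alpha (alpha + 1) <= fixpt N e ->
  alpha <= x -> x < y -> y <= alpha + 1 -> bad (Tmap N alpha) U x y ->
  bad (Tmap N alpha) U alpha (alpha + 1).
Proof.
move=> N2 a0 e2 dal dbe hT ax xy yb bxy.
have N0 : (0 < N)%N by apply: leq_trans N2.
have e1 : 1 <= e by apply: le_trans e2.
have e0 : 0 <= e by apply: le_trans e1.
have i0 : 0 <= e + 2 by rewrite addr_ge0.
have i1 : 0 <= e + 1 by rewrite addr_ge0.
have j0 : 0 <= e - 1 by rewrite subr_ge0.
have ee : e + 2 = e + 1 + 1 by ring.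
have alp := cut_gt_alpha a0 i0 dal.
have rbe := cut_lt_end a0 j0 dbe; rewrite subrK in rbe.
have pq : cut N alpha (e + 2) < cut N alpha (e + 1) by apply: cut_anti => //; rewrite ltrD2l.
have qr : cut N alpha (e + 1) < cut N alpha e by apply: cut_anti => //; rewrite ltrDl.
have qbe := lt_trans qr rbe; have pbe := lt_trans pq qbe.
have alq := lt_trans alp pq; have alr := lt_trans alq qr.
have /andP[pf fq] := fixpt_cut N0 a0 e1 alq rbe.
have [f0 fN] := fixptP (R := R) e N0.
have f_fix : N%:R / fixpt N e - e%:~R = fixpt N e :> R.
  by rewrite -fN; field; rewrite lt0r_neq0.
have c0 : 0 < fixpt N e + e%:~R :> R by rewrite ltr_wpDr // ler0z.
have N_gt0 : 0 < N%:R :> R by rewrite ltr0n.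
have [Ta Al Au] := Tmap_alpha dal; have [Tb Cl Cu] := Tmap_beta dbe.
have ha := hfunK (addr_gt0 a0 c0).
have hb := hfunK (addr_gt0 (addr_gt0 a0 ltr01) c0).
have al_f : alpha <= fixpt N e := ltW (lt_trans alq pf).
have f_be : fixpt N e < alpha + 1 := lt_trans fq rbe.
have E1 : (e + 2)%:~R = e%:~R + 2 :> R by rewrite intrD.
have E2 : (e - 1)%:~R = e%:~R - 1 :> R by rewrite intrB.
have e2' : 2 <= e%:~R :> R by rewrite (_ : 2 = 2%:~R) // ler_int.
rewrite Tb in hT.
have h0 : 2 <= fixpt N e * (fixpt N e + e%:~R) :> R by rewrite fN ler_nat.
have h1 : fixpt N e * (fixpt N e + e%:~R) <= (alpha + 1) * (fixpt N e + e%:~R - 1).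
  by have := ger_cross (addr_gt0 a0 ltr01) hT; rewrite fN E2 mulrC addrA.
have h2 : alpha * (alpha + e%:~R + 2) < fixpt N e * (fixpt N e + e%:~R).
  by move: alp; rewrite fN /cut E1 addrA ltr_pdivlMr // -addrA -E1 cut_den_gt0.
have [fk gk] := @rates_four_right R alpha (fixpt N e) e%:~R _ _ a0 f0 al_f f_be e2' erefl h0 h1
  h2 hb.
have kB : fixpt N e ^+ 2 <= 45 / 100 * N%:R :> R.
  by rewrite -fN expr2 [leRHS]mulrCA; apply: ler_wpM2l (ltW f0) _ _ _.
rewrite fN in gk.
have ee1 : e - (e - 1) = 1 by ring.
have le1 : e - 1 <= e by rewrite gerBl.
have le2 : e <= e + 2 by rewrite lerDl.
have le3 : e <= e + 1 by rewrite lerDl.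
have brA := first_branch U N0 a0 e0 i0 dal (ltW pbe)
  (fun x ax _ => rate_low (fixpt N e) le2 c0 a0 ax) kB.
have brB := middle_branch U N0 a0 e0 i1; rewrite -ee in brB.
have {}brB := brB _ _ (ltW alp) (ltW qbe) (fun x ax _ => rate_low (fixpt N e) le3 c0 a0 ax) kB.
have brC := middle_branch U N0 a0 e0 e0 (ltW alq) (ltW rbe)
  (fun x ax _ => rate_low (fixpt N e) (lexx e) c0 a0 ax) kB.
have gD : forall x, alpha <= x -> x <= alpha + 1 -> fixpt N e + (e - (e - 1))%:~R *
    hfun (fixpt N e + e%:~R) x <= fixpt N e + hfun (fixpt N e + e%:~R) (alpha + 1).
  by move=> t t1 t2; have := rate_high (fixpt N e) le1 c0 a0 t1 t2; rewrite ee1 !mul1r.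
have brD := last_branch U N0 a0 e0 j0 dbe; rewrite subrK in brD.
have {}brD := brD _ _ (ltW alr) gD gk.
have A_p := cut_low N0 a0 i0; have B_q := cut_low N0 a0 i1.
have B_p : N%:R / cut N alpha (e + 2) - (e + 1)%:~R = alpha + 1.
  by have := cut_high N0 a0 i1; rewrite -ee.
have C_q := cut_high N0 a0 e0; have C_r := cut_low N0 a0 e0.
have D_r : N%:R / cut N alpha e - (e - 1)%:~R = alpha + 1.
  by have := cut_high N0 a0 j0; rewrite subrK.
apply: (four_branch_mirror (bad_familyP _ _) (hfun_mono c0 a0 (be := alpha + 1)) alp pq pf fq rbe
  _ _ _ _ _ _ _ _ brA brB brC brD A_p B_p B_q C_q C_r D_r f_fix hT _ _ _ ax xy yb bxy);
  clear; lra.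
Qed.
End Spreading.

(** * Inverse branches as Moebius maps *)

Section Mobius.
Context {R : realType}.
Implicit Types (phi psi : R -> R).

(** Increasing Moebius maps without pole or zero on the positive half-line:
    nonnegative coefficients make the family stable under composition with a
    distortion bound that is uniform over all compositions. *)
Definition mobius phi := exists A B C E : R,
  [/\ 0 <= A, 0 <= B, 0 <= C, 0 <= E & B * C < A * E] /\
  forall y, 0 < y -> phi y = (A * y + B) / (C * y + E).

Lemma mobius_id : mobius id.
Proof.
exists 1, 0, 0, 1; split; first by split => //; lra.
by move=> y y0; rewrite mul1r mul0r addr0 add0r divr1.
Qed.

Lemma mobius_den (A B C E y : R) : 0 <= A -> 0 <= B -> 0 <= C -> 0 <= E ->
  B * C < A * E -> 0 < y -> [/\ 0 < E, 0 < A * y + B & 0 < C * y + E].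
Proof.
move=> A0 B0 C0 E0 det y0.
have AE : 0 < A * E by apply: le_lt_trans det; apply: mulr_ge0.
have Ap : 0 < A by rewrite lt_neqAle A0 andbT; apply: contraTN AE => /eqP <-; rewrite mul0r ltxx.
have Ep : 0 < E by rewrite lt_neqAle E0 andbT; apply: contraTN AE => /eqP <-; rewrite mulr0 ltxx.
by split=> //; [rewrite ltr_wpDr // mulr_gt0 | rewrite ltr_wpDl // mulr_ge0 // ltW].
Qed.

Lemma mobius_pos phi y : mobius phi -> 0 < y -> 0 < phi y.
Proof.
move=> [A [B [C [E [[A0 B0 C0 E0 det] H]]]]] y0; rewrite H //.
by have [_ num den] := mobius_den A0 B0 C0 E0 det y0; apply: divr_gt0.
Qed.

Lemma mobius_comp phi psi : mobius phi -> mobius psi -> mobius (phi \o psi).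
Proof.
move=> [A [B [C [E [[A0 B0 C0 E0 det] H]]]]] mpsi.
have psi0 y : 0 < y -> 0 < psi y by apply: mobius_pos.
case: mpsi => [A' [B' [C' [E' [[A0' B0' C0' E0' det'] H']]]]].
exists (A * A' + B * C'), (A * B' + B * E'), (C * A' + E * C'), (C * B' + E * E'); split.
  split; rewrite ?addr_ge0 ?mulr_ge0 //.
  have : 0 < (A * E - B * C) * (A' * E' - B' * C') by rewrite mulr_gt0 // subr_gt0.
  lra.
move=> y y0 /=; rewrite H; last exact: psi0.
rewrite H' //.
have [_ num0 d0] := mobius_den A0' B0' C0' E0' det' y0.
have [E1 _ _] := mobius_den A0 B0 C0 E0 det y0.
have d1 : 0 < C * (A' * y + B') + E * (C' * y + E').
  by rewrite ltr_wpDl ?mulr_gt0 // mulr_ge0 // ltW.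
have -> : (C * A' + E * C') * y + (C * B' + E * E') = C * (A' * y + B') + E * (C' * y + E') by
  ring.
by field; rewrite !lt0r_neq0.
Qed.

(** [phi y - phi x] is [y - x] times the determinant over the product of
    the denominators at [x] and [y], and a denominator varies by a factor at
    most [be / al] over [[al, be]]. *)
Lemma mobius_dist phi (al be s t a b : R) : mobius phi -> 0 < al -> al <= be ->
  al <= s -> s <= t -> t <= be -> al <= a -> a <= b -> b <= be ->
  (phi t - phi s) * (b - a) <= (be / al) ^+ 2 * ((phi b - phi a) * (t - s)).
Proof.
move=> [A [B [C [E [[A0 B0 C0 E0 det] H]]]]] a0 alb als st tb ala ab bb.
have be0 : 0 < be by lra.
have den y : 0 < y -> 0 < C * y + E by case/(mobius_den A0 B0 C0 E0 det).
have s0 : 0 < s by lra.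
have t0 : 0 < t by lra.
have aa0 : 0 < a by lra.
have b0 : 0 < b by lra.
have diff x y : 0 < x -> 0 < y -> phi y - phi x = (A * E - B * C) * (y - x) / ((C * x + E) * (C *
  y + E)).
  by move=> x0 y0; rewrite !H //; field; rewrite !lt0r_neq0 // den.
rewrite !diff //.
have cmp x y : al <= x -> x <= be -> al <= y -> y <= be -> (C * x + E) <= be / al * (C * y + E).
  move=> x1 x2 y1 y2.
  have k1 : x <= be / al * y.
    rewrite mulrAC ler_pdivlMr //; apply: ler_pM => //; lra.
  have k2 : 1 <= be / al by rewrite ler_pdivlMr // mul1r.
  have : C * x <= C * (be / al * y) by rewrite ler_wpM2l.
  have : E <= be / al * E by rewrite ler_peMl.
  lra.
set De := A * E - B * C; have De0 : 0 <= De by rewrite subr_ge0 ltW.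
have -> : De * (t - s) / ((C * s + E) * (C * t + E)) * (b - a)
   = De * (t - s) * (b - a) * ((C * a + E) * (C * b + E)) / (((C * s + E) * (C * t + E)) * ((C *
     a + E) * (C * b + E))).
  by field; rewrite !lt0r_neq0 // den.
have -> : (be / al) ^+ 2 * (De * (b - a) / ((C * a + E) * (C * b + E)) * (t - s))
   = De * (t - s) * (b - a) * ((be / al * (C * s + E)) * (be / al * (C * t + E))) / (((C * s + E)
     * (C * t + E)) * ((C * a + E) * (C * b + E))).
  by field; rewrite !lt0r_neq0 // den.
rewrite ler_pM2r; last by rewrite invr_gt0 !mulr_gt0 // den.
apply: ler_wpM2l; first by rewrite !mulr_ge0 // subr_ge0.
apply: ler_pM; rewrite ?(ltW (den _ _)) //; apply: cmp; lra.
Qed.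

Lemma mobius_mono phi x y : mobius phi -> 0 < x -> x < y -> phi x < phi y.
Proof.
move=> [A [B [C [E [[A0 B0 C0 E0 det] H]]]]] x0 xy.
have y0 : 0 < y by lra.
have den z : 0 < z -> 0 < C * z + E by case/(mobius_den A0 B0 C0 E0 det).
have diff : phi y - phi x = (A * E - B * C) * (y - x) / ((C * x + E) * (C * y + E)).
  by rewrite !H //; field; rewrite !lt0r_neq0 // den.
by rewrite -subr_gt0 diff divr_gt0 ?mulr_gt0 ?subr_gt0 ?den.
Qed.

Lemma mobius_surj phi s t z : mobius phi -> 0 < s -> s < t -> phi s < z -> z < phi t ->
  exists y, [/\ s < y, y < t & phi y = z].
Proof.
move=> mphi s0 st; have := mphi; move=> [A [B [C [E [[A0 B0 C0 E0 det] H]]]]].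
have t0 : 0 < t by lra.
have den x : 0 < x -> 0 < C * x + E by case/(mobius_den A0 B0 C0 E0 det).
rewrite !H // => h1 h2.
have k1 : A * s + B < z * (C * s + E) by rewrite -ltr_pdivrMr // den.
have k2 : z * (C * t + E) < A * t + B by rewrite -ltr_pdivlMr // den.
have k3 : 0 < A - C * z.
  have : (C * z) * (C * t + E) <= C * (A * t + B) by rewrite -mulrA ler_wpM2l // ltW.
  move=> k; rewrite ltNge; apply/negP => k4.
  have : A * (C * t + E) <= C * z * (C * t + E) by rewrite ler_wpM2r ?(ltW (den _ _)) //; lra.
  lra.
have y1 : s < (E * z - B) / (A - C * z) by rewrite ltr_pdivlMr //; lra.
have y2 : (E * z - B) / (A - C * z) < t by rewrite ltr_pdivrMr //; lra.
exists ((E * z - B) / (A - C * z)); split => //.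
have y0 := lt_trans s0 y1.
rewrite H //.
have -> : C * ((E * z - B) / (A - C * z)) + E = (A * E - B * C) / (A - C * z) by field; rewrite
  lt0r_neq0.
have det0 : A * E - B * C != 0 by rewrite lt0r_neq0 // subr_gt0.
by field; rewrite det0 lt0r_neq0.
Qed.

(** Single inverse branches are decreasing; composing them in pairs keeps to
    increasing maps. *)
Lemma mobius_two (n i j : R) : 0 < n -> 0 <= i -> 0 <= j ->
  mobius (fun z => n / (n / (z + j) + i)).
Proof.
move=> n0 i0 j0; exists n, (n * j), i, (n + i * j); split.
  split; rewrite ?mulr_ge0 ?addr_ge0 ?mulr_ge0 // ?(ltW n0) //.
  have : 0 < n * n by apply: mulr_gt0.
  lra.
move=> y y0.
have yj : 0 < y + j by lra.
have d1 : 0 < i * y + (n + i * j) by rewrite ltr_wpDl ?mulr_ge0 ?(ltW y0) // ltr_wpDr ?mulr_ge0.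
have -> : n / (y + j) + i = (i * y + (n + i * j)) / (y + j) by field; rewrite lt0r_neq0.
by field; rewrite !lt0r_neq0.
Qed.
End Mobius.

Section FinitePoints.
Context {R : realType}.
Implicit Types (s : seq R).

Definition cnt s (a b : R) := count (fun x => (a < x) && (x < b)) s.

Lemma cnt_split s a p b : p \in s -> a < p -> p < b -> (cnt s a p + cnt s p b < cnt s a b)%N.
Proof.
move=> ps ap pb.
have pt x : (((a < x) && (x < p))%R + ((p < x) && (x < b))%R <= ((a < x) && (x < b))%R)%N.
  have [xp|px|->] := ltgtP x p.
  - by rewrite (lt_trans xp pb) !andbT addn0.
  - by rewrite (lt_trans ap px) andbF add0n.
  - by rewrite ?ltxx ?andbF ?addn0.
have le l : (cnt l a p + cnt l p b <= cnt l a b)%N.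
  by rewrite /cnt; elim: l => //= x l IH; rewrite addnACA leq_add.
elim: s ps => //= x s IH; rewrite inE /cnt /= addnACA => /predU1P[<-|/IH {}IH].
  by rewrite ap pb !ltxx; apply: (le s).
by rewrite -addnS leq_add.
Qed.

Lemma cnt0 s a b : cnt s a b = 0%N -> forall x, x \in s -> a < x -> x < b -> False.
Proof.
move=> /eqP; rewrite -leqn0 leqNgt -has_count => /hasPn H x xs ax xb.
by move: (H _ xs); rewrite ax xb.
Qed.

Lemma cnt_gt0 s a b : (0 < cnt s a b)%N -> exists p, [/\ p \in s, a < p & p < b].
Proof. by rewrite -has_count => /hasP[p ps /andP[ap pb]]; exists p. Qed.

(** Take for [d0] the least distance between two points of [s]. *)
Lemma cnt_le1 s : uniq s -> exists2 d0 : R, 0 < d0 & forall a b, b - a <= d0 ->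
  (cnt s a b <= 1)%N.
Proof.
elim: s => [|x s IH] /=; first by move=> _; exists 1.
move=> /andP[xs /IH[d1 d10 H1]].
have [d2 d20 H2] : exists2 d2 : R, 0 < d2 & forall y, y \in s -> d2 <= `|x - y|.
  elim: s xs {IH H1} => [|y s IH]; first by exists 1.
  rewrite inE negb_or => /andP[xy /IH[d2 d20 H2]].
  exists (Num.min d2 `|x - y|); first by rewrite lt_min d20 normr_gt0 subr_eq0.
  by move=> z; rewrite inE => /predU1P[->|/H2 h]; rewrite ge_min ?lexx ?orbT // h.
exists (Num.min d1 d2); first by rewrite lt_min d10.
move=> a b; rewrite le_min => /andP[h1 h2]; rewrite /cnt /=.
have [/andP[ax xb]|_] := boolP ((a < x) && (x < b)); last by rewrite add0n H1.
rewrite /= -[X in (_ <= X)%N]addn0 leq_add2l leqNgt -has_count; apply/hasPn => y ys /=.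
apply/negP => /andP[ay yb]; have := H2 _ ys.
rewrite leNgt => /negP; apply; rewrite ltr_norml; apply/andP; split; lra.
Qed.
End FinitePoints.

(** Each of the at most [cnt s a b + 1] intervals between consecutive
    points of [s] loses [c * Q], and [ell] is superadditive. *)
Lemma split_content {R : realType} (s : seq R) (phi : R -> R) (ell : R -> R ->
  R) (c P Q a b : R) :
  0 < a -> a < b -> mobius phi -> 0 <= c * Q ->
  (forall u v w, u < v -> v < w -> ell u v + ell v w <= ell u w) ->
  (forall x y, a <= x -> x < y -> y <= b -> (forall p, p \in s -> x < p -> p < y -> False) ->
     c * ((phi y - phi x) * P - Q) <= ell (phi x) (phi y)) ->
  c * ((phi b - phi a) * P - (cnt s a b).+1%:R * Q) <= ell (phi a) (phi b).
Proof.
move=> a0 ab mphi Q0 sup Hnice.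
have main n : forall x y, a <= x -> x < y -> y <= b -> (cnt s x y <= n)%N ->
   c * ((phi y - phi x) * P - (cnt s x y).+1%:R * Q) <= ell (phi x) (phi y).
  elim: n => [|n IH] x y ax xy yb.
    rewrite leqn0 => /eqP c0; rewrite c0 mul1r; apply: Hnice => //; exact: (cnt0 c0).
  move=> cn; have [c0|c0] := posnP (cnt s x y).
    by rewrite c0 mul1r; apply: Hnice => //; exact: (cnt0 c0).
  have [p [ps xp py]] := cnt_gt0 c0.
  have sp := cnt_split ps xp py.
  have i1 := IH x p ax xp (ltW (lt_le_trans py yb)) (leq_trans (leq_addr _ _) (leq_trans sp cn)).
  have i2 := IH p y (ltW (le_lt_trans ax xp)) py yb (leq_trans (leq_addl _ _) (leq_trans sp cn)).
  have x0 : 0 < x by apply: lt_le_trans ax.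
  have i3 := sup _ _ _ (mobius_mono mphi x0 xp) (mobius_mono mphi (lt_trans x0 xp) py).
  apply: le_trans i3; apply: le_trans (lerD i1 i2).
  have : (cnt s x p + cnt s p y).+2%:R * (c * Q) <= (cnt s x y).+1%:R * (c * Q).
    by rewrite ler_wpM2r // ler_nat ltnS.
  have -> : (cnt s x p + cnt s p y).+2%:R = (cnt s x p).+1%:R + (cnt s p y).+1%:R :> R.
    by rewrite -natrD addSn addnS.
  lra.
exact: (main _ a b (lexx a) ab (lexx b) (leqnn _)).
Qed.

Section CutFree.
Context {R : realType}.
Implicit Types (N : nat) (alpha : R).

(** A finite set outside of which the digits of [x] and of its first [k - 1]
    iterates are locally constant: the preimages of the cut points, of all orders
    less than [k], under all branches of digit less than [D], where [D] exceeds all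
    digits. *)
Fixpoint cuts (n al : R) (D k : nat) : seq R :=
  if k is k'.+1 then [seq n / (al + j%:R) | j <- iota 0 D] ++
                     [seq n / (s + j%:R) | s <- cuts n al D k', j <- iota 0 D]
  else [::].

Definition avoids (s : seq R) (a b : R) := forall p, p \in s -> a < p -> p < b -> False.

Lemma divKr_pos (n x : R) : 0 < n -> 0 < x -> n / (n / x) = x.
Proof. by move=> n0 x0; field; rewrite !lt0r_neq0. Qed.

(** The digit at the midpoint is the digit throughout, since a change of
    digit would happen at a cut point. *)
Lemma cut_free_branch N alpha D a b k : 0 < alpha -> (alpha + 1) ^+ 2 <= N%:R ->
  N%:R / alpha < D%:R ->
  alpha <= a -> a < b -> b <= alpha + 1 -> avoids (cuts N%:R alpha D k.+1) a b ->
  exists i : nat, [/\ (0 < i)%N, alpha <= N%:R / b - i%:R, N%:R / a - i%:R <= alpha + 1,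
     (forall x, a < x -> x < b -> Tmap N alpha x = N%:R / x - i%:R) &
     avoids (cuts N%:R alpha D k) (N%:R / b - i%:R) (N%:R / a - i%:R)].
Proof.
move=> a0 N2 ND aa ab bb av; set n : R := N%:R in N2 ND av *.
have n0 : 0 < n by apply: lt_le_trans N2; rewrite exprn_gt0 //; lra.
have av1 j : (j < D)%N -> a < n / (alpha + j%:R) -> n / (alpha + j%:R) < b -> False.
  move=> jD; apply: av; rewrite mem_cat; apply/orP; left.
  by apply/mapP; exists j => //; rewrite mem_iota.
have ap j : 0 < alpha + j%:R by rewrite ltr_wpDr.
have [m [am mb]] : exists m, a < m /\ m < b by exists ((a + b) / 2); lra.
have m0 : 0 < m by lra.
have le_na x : alpha <= x -> n / x <= n / alpha.
  by move=> ax; rewrite ler_pM2l // lef_pV2 ?posrE //; lra.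
have nm1 : 1 <= n / m - alpha.
  have : alpha + 1 <= n / m.
    by rewrite ler_pdivlMr //; apply: le_trans N2; rewrite expr2 ler_wpM2l; lra.
  lra.
have /andP[i1 i2] := truncn_itv (le_trans ler01 nm1).
set i := Num.truncn _ in i1 i2.
have ige : (0 < i)%N.
  have : 1 < i.+1%:R :> R by apply: le_lt_trans i2.
  by rewrite ltr1n ltnS.
have iD : (i < D)%N.
  by rewrite -(ltr_nat R); have := le_na m; lra.
have jD x : alpha <= x -> i.+1%:R + alpha <= n / x -> (i.+1 < D)%N.
  by move=> ax h; rewrite -(ltr_nat R); have := le_na x ax; lra.
have yi : m <= n / (alpha + i%:R) by rewrite ler_pdivlMr // mulrC -ler_pdivlMr //; lra.
have yi1 : n / (alpha + i.+1%:R) < m by rewrite ltr_pdivrMr // mulrC -ltr_pdivrMr //; lra.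
have lowi x : a < x -> x <= b -> alpha + i%:R <= n / x.
  move=> ax xb; rewrite leNgt; apply/negP => h.
  have x0 : 0 < x by lra.
  apply: (av1 i) => //; first by lra.
  apply: lt_le_trans xb.
  by rewrite ltr_pdivrMr // mulrC -ltr_pdivrMr.
exists i; split => //.
- have := lowi b ab (lexx b); lra.
- rewrite leNgt; apply/negP => h.
  have aa0 : 0 < a by lra.
  apply: (av1 i.+1).
  + by apply: (jD a) => //; rewrite -natr1; lra.
  + by rewrite ltr_pdivlMr // mulrC -ltr_pdivlMr // -natr1; lra.
  + by lra.
- move=> x ax xb; have x0 : 0 < x by lra.
  apply: (Tmap_itv (i := Posz i)); first by apply/eqP => ?; lra.
    by rewrite -/n; have := lowi x ax (ltW xb); rewrite -pmulrn; lra.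
  rewrite -/n -pmulrn ltNge; apply/negP => h.
  have h' : alpha + i.+1%:R <= n / x by rewrite -natr1; lra.
  apply: (av1 i.+1).
  + by apply: (jD x); lra.
  + by apply: (lt_le_trans ax); rewrite ler_pdivlMr // mulrC -ler_pdivlMr.
  + by lra.
- move=> s sc h1 h2.
  have b0 : 0 < b by lra.
  have aa0 : 0 < a by lra.
  have nb0 : 0 < n / b by rewrite divr_gt0.
  have si : 0 < s + i%:R by lra.
  apply: (av (n / (s + i%:R))).
  + rewrite mem_cat; apply/orP; right; apply/allpairsP; exists (s, i) => /=.
    by rewrite mem_iota.
  + by rewrite ltr_pdivlMr // mulrC -ltr_pdivlMr //; lra.
  + by rewrite ltr_pdivrMr // mulrC -ltr_pdivrMr //; lra.
Qed.

(** At a point [x] of digit [i >= 1], two steps expand by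
    [(N / (x * T x)) ^+ 2], and [x * T x = N - i * x <= N - alpha]. On an interval
    the same estimate holds with [x] and [T x] taken at the appropriate ends. *)
Lemma cut_free_inverse N alpha D k a b : 0 < alpha -> (alpha + 1) ^+ 2 <= N%:R ->
  N%:R / alpha < D%:R ->
  alpha <= a -> a < b -> b <= alpha + 1 -> avoids (cuts N%:R alpha D k.*2) a b ->
  exists phi a' b', [/\ mobius phi, alpha <= a', a' < b' & b' <= alpha + 1] /\
   [/\ phi a' = a, phi b' = b, (forall z, a' < z -> z < b' -> iter k.*2 (Tmap N alpha) (phi z) =
     z)
     & (N%:R / (N%:R - alpha)) ^+ k.*2 * (b - a) <= b' - a'].
Proof.
move=> a0 N2 ND; elim: k a b => [|k IH] a b aa ab bb av.
  exists id, a, b; split; split => //; first exact: mobius_id.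
  by rewrite expr0 mul1r.
set n : R := N%:R in N2 ND av IH *.
have n0 : 0 < n by apply: lt_le_trans N2; rewrite exprn_gt0 //; lra.
have nal : 0 < n - alpha by rewrite expr2 in N2; have : 0 < alpha * alpha by [apply: mulr_gt0];
  lra.
have [i [i0 I1 I2 IT Iav]] := cut_free_branch a0 N2 ND aa ab bb av.
rewrite -/n in I1 I2 IT Iav.
have aa0 : 0 < a by lra.
have b0 : 0 < b by lra.
have ab1 : n / b - i%:R < n / a - i%:R by rewrite ltrD2r ltr_pM2l // ltf_pV2.
have [j [j0 J1 J2 JT Jav]] := cut_free_branch a0 N2 ND I1 ab1 I2 Iav.
rewrite -/n in J1 J2 JT Jav.
set a1 := n / b - i%:R in I1 ab1 J1 J2 JT Jav *; set b1 := n / a - i%:R in I2 ab1 J1 J2 JT Jav *.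
have a10 : 0 < a1 by lra.
have b10 : 0 < b1 by lra.
have ab2 : n / b1 - j%:R < n / a1 - j%:R by rewrite ltrD2r ltr_pM2l // ltf_pV2.
have [psi [a' [b' [[mpsi A1 A2 A3] [B1 B2 B3 B4]]]]] := IH _ _ J1 ab2 J2 Jav.
set a2 := n / b1 - j%:R in J1 ab2 B1 B4; set b2 := n / a1 - j%:R in J2 ab2 B2 B4.
have i0r : 0 <= i%:R :> R by [].
have j0r : 0 <= j%:R :> R by [].
pose two z : R := n / (n / (z + j%:R) + i%:R).
have ta : two a2 = a.
  by rewrite /two /a2 subrK divKr_pos // /b1 subrK divKr_pos.
have tb : two b2 = b.
  by rewrite /two /b2 subrK divKr_pos // /a1 subrK divKr_pos.
have mtwo : mobius two by apply: mobius_two.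
have a'0 : 0 < a' by lra.
exists (two \o psi), a', b'; split; first by split => //; apply: mobius_comp.
split.
- by rewrite /= B1.
- by rewrite /= B2.
- move=> z z1 z2; rewrite doubleS -addn2 iterD /=.
  have p1 : a2 < psi z by rewrite -B1; apply: mobius_mono.
  have p2 : psi z < b2 by rewrite -B2; apply: mobius_mono => //; lra.
  have pz : 0 < psi z by lra.
  have t1 : a < two (psi z) by rewrite -ta; apply: mobius_mono => //; lra.
  have t2 : two (psi z) < b by rewrite -tb; apply: mobius_mono => //; lra.
  have pj : 0 < psi z + j%:R by rewrite ltr_wpDr.
  have pj' : 0 < n / (psi z + j%:R) by apply: divr_gt0.
  have T1 : Tmap N alpha (two (psi z)) = n / (psi z + j%:R).
    by rewrite IT // /two divKr_pos ?addrK // ltr_wpDr.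
  have T2 : Tmap N alpha (n / (psi z + j%:R)) = psi z.
    rewrite JT; first by rewrite divKr_pos // addrK.
    - by rewrite ltr_pdivlMr ?ltr_wpDr // mulrC -ltr_pdivlMr //; rewrite /b2 in p2; lra.
    - by rewrite ltr_pdivrMr ?ltr_wpDr // mulrC -ltr_pdivrMr //; rewrite /a2 in p1; lra.
  by rewrite T1 T2 B3.
- have expand : (n / (n - alpha)) ^+ 2 * (b - a) <= b2 - a2.
    have i1r : 1 <= i%:R :> R by rewrite ler1n.
    have e1 : b2 - a2 = n * (b1 - a1) / (a1 * b1).
      by rewrite /b2 /a2; field; rewrite !lt0r_neq0.
    have e2 : b1 - a1 = n * (b - a) / (a * b).
      by rewrite /b1 /a1; field; rewrite !lt0r_neq0.
    have -> : b2 - a2 = n ^+ 2 * (b - a) / ((a * b1) * (b * a1)).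
      by rewrite e1 e2; field; rewrite !lt0r_neq0.
    rewrite expr_div_n mulrAC ler_wpM2l ?mulr_ge0 ?subr_ge0 ?(ltW ab) ?exprn_ge0 ?(ltW n0) //.
    rewrite lef_pV2 ?posrE ?mulr_gt0 ?exprn_gt0 //.
    rewrite expr2; apply: ler_pM; rewrite ?mulr_ge0 ?(ltW aa0) ?(ltW b10) ?(ltW b0) ?(ltW a10) //.
    + by rewrite /b1 mulrBr mulrCA divff ?lt0r_neq0 // mulr1 lerB //; nra.
    + by rewrite /a1 mulrBr mulrCA divff ?lt0r_neq0 // mulr1 lerB //; nra.
  rewrite doubleS -addn2 exprD -mulrA; apply: le_trans B4; apply: ler_wpM2l expand.
  by rewrite exprn_ge0 // divr_ge0 // ltW.
Qed.
End CutFree.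

(** * A uniform lower bound for late visits *)

Section LowerBound.
Context {R : realType}.
Implicit Types (N : nat) (alpha : R) (U : set R).

(** Cut the interval into cells of length [d / 2]: an interval of length
    [d] contains a cell, and finitely many cells have a common [eta]. *)
Lemma uniform_hits (T : R -> R) U al be d : 0 < d -> al < be ->
  (forall x y, al <= x -> x < y -> y <= be -> hits T U x y) ->
  exists2 eta, 0 < eta & forall a b, al <= a -> b <= be -> d <= b - a ->
    exists s t n, [/\ a <= s, t <= b, eta <= t - s & forall z, s < z -> z < t -> U (iter n T z)].
Proof.
move=> d0 albe H; pose L := d / 2; have L0 : 0 < L by rewrite /L; lra.
have grid m : exists2 eta, 0 < eta & forall i, (i < m)%N -> al + i.+1%:R * L <= be ->
    exists s t n, [/\ al + i%:R * L <= s, t <= al + i.+1%:R * L, eta <= t - s &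
      forall z, s < z -> z < t -> U (iter n T z)].
  elim: m => [|m [eta eta0 IH]]; first by exists 1.
  have [hm|hm] := lerP (al + m.+1%:R * L) be; last first.
    exists eta => // i; rewrite ltnS leq_eqVlt => /predU1P[->|im]; last exact: IH.
    by rewrite leNgt hm.
  have [|||s [t [n [h1 h2 h3 h4]]]] := H (al + m%:R * L) (al + m.+1%:R * L) => //.
  - by rewrite lerDl mulr_ge0 // ltW.
  - by rewrite ltrD2l ltr_pM2r // ltr_nat.
  exists (Num.min eta (t - s)); first by rewrite lt_min eta0 subr_gt0.
  move=> i; rewrite ltnS leq_eqVlt => /predU1P[->|im] hi.
    by exists s, t, n; split => //; rewrite ge_min lexx orbT.
  have [s' [t' [n' [k1 k2 k3 k4]]]] := IH i im hi.
  by exists s', t', n'; split => //; rewrite ge_min k3.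
have [eta eta0 He] := grid (Num.truncn ((be - al) / L)).+1.
exists eta => // a b ala bb dab.
have q0 : 0 <= (a - al) / L by rewrite divr_ge0 ?subr_ge0 // ltW.
have /andP[i1 i2] := truncn_itv q0.
set j := Num.truncn _ in i1 i2.
have i1' : j%:R * L <= a - al by rewrite -ler_pdivlMr.
have i2' : a - al < j.+1%:R * L by rewrite -ltr_pdivrMr.
have jL : j.+2%:R * L = j%:R * L + d by rewrite -addn2 natrD /L; lra.
have jb : al + j.+2%:R * L <= be by lra.
have [|s [t [n [k1 k2 k3 k4]]]] := He j.+1 _ jb.
  rewrite ltnS -(ler_nat R).
  have q1 : 0 <= (be - al) / L by rewrite divr_ge0 ?subr_ge0 // ltW.
  have /andP[_ i3] := truncn_itv q1.
  have : j.+1%:R < (Num.truncn ((be - al) / L)).+1%:R :> R.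
    apply: le_lt_trans i3; rewrite ler_pdivlMr //.
    have : j.+1%:R * L <= j.+2%:R * L by rewrite ler_wpM2r ?(ltW L0) // ler_nat.
    lra.
  by rewrite ltr_nat ltnS ler_nat.
by exists s, t, n; split => //; [move: k1 | move: k2]; clear -i1' i2' jL dab; lra.
Qed.

Lemma pow_unbounded (x M : R) : 1 < x -> exists k : nat, M <= x ^+ k.
Proof.
move=> x1; have bern k : 1 + k%:R * (x - 1) <= x ^+ k.
  elim: k => [|k IH]; first by rewrite mul0r addr0.
  rewrite exprS -natr1; apply: (@le_trans _ _ (x * (1 + k%:R * (x - 1)))).
    have : 0 <= k%:R * (x - 1) * (x - 1) by rewrite !mulr_ge0 // subr_ge0 ltW.
    lra.
  by rewrite ler_wpM2l //; lra.
have [M0|M0] := lerP M 0; first by exists 0%N; rewrite expr0; lra.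
exists (Num.truncn (M / (x - 1))).+1; apply: le_trans (bern _).
have q0 : 0 <= M / (x - 1) by rewrite divr_ge0 ?subr_ge0 // ltW.
have /andP[_ h] := truncn_itv q0.
have : M < (Num.truncn (M / (x - 1))).+1%:R * (x - 1) by rewrite -ltr_pdivrMr // subr_gt0.
lra.
Qed.

(** The content [ell s t] stands for the measure of the points between
    [s] and [t] that visit [U] at or after time [n0]. The inequality [claim] is
    about the image of an interval [(a, b)] under a Moebius map [phi] inverse to
    [T ^ M] there. If [b - a] is not small, a subinterval of definite length is
    mapped into [U], and bounded distortion transports this proportion to the
    image. In general, wait [2 * k] more steps: between two cuts an interval is
    expanded by at least 4 times the distortion bound, so that a piece loses at most
    a quarter of the loss [dl / (b - a)] allowed for short intervals. A short
    interval has at most 2 pieces, and its loss is halved; a long one has a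
    bounded number of pieces and adds a multiple of [(1/2) ^+ n], which is
    summable. *)
Lemma lower_bound N alpha U : 0 < alpha -> (alpha + 1) ^+ 2 <= N%:R ->
  (forall x y, alpha <= x -> x < y -> y <= alpha + 1 -> hits (Tmap N alpha) U x y) ->
  exists2 c, 0 < c & forall (n0 : nat) (ell : R -> R -> R),
    (forall u v, 0 <= ell u v) ->
    (forall u v w, u < v -> v < w -> ell u v + ell v w <= ell u w) ->
    (forall u v s t, u <= s -> s < t -> t <= v -> ell s t <= ell u v) ->
    (forall s t k, (n0 <= k)%N -> s < t ->
       (forall z, s < z -> z < t -> U (iter k (Tmap N alpha) z)) -> t - s <= ell s t) ->
    c <= ell alpha (alpha + 1).
Proof.
move=> a0 N2 H; set be := alpha + 1; set T := Tmap N alpha.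
have albe : alpha < be by rewrite /be; lra.
have be0 : 0 < be by rewrite /be; lra.
have n0 : 0 < N%:R :> R by apply: lt_le_trans N2; rewrite exprn_gt0.
have nal : 0 < N%:R - alpha.
  by have : 0 < alpha * alpha by [apply: mulr_gt0]; move: N2; rewrite expr2; lra.
(* Digits are smaller than [Dn], and [Dd] bounds the distortion. *)
pose Dn := (Num.truncn (N%:R / alpha)).+1.
have ND : N%:R / alpha < Dn%:R.
  by have /andP[] := truncn_itv (ltW (divr_gt0 n0 a0)).
pose Dd : R := (be / alpha) ^+ 2.
have Dd1 : 1 <= Dd by rewrite exprn_ege1 // ler_pdivlMr // mul1r ltW.
have Dd0 : 0 < Dd by lra.
(* After [2 * k] steps a cut-free interval has grown by 4 times the distortion
   bound: one factor 2 pays for the cut, the other halves the loss. *)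
have [k hk] : exists k, 4 * Dd <= (N%:R / (N%:R - alpha)) ^+ k.*2.
  have [|k hk] := @pow_unbounded (N%:R / (N%:R - alpha)) (4 * Dd).
    by rewrite ltr_pdivlMr // mul1r; lra.
  exists k; apply: le_trans hk _; rewrite -addnn exprD ler_peMr //.
    by rewrite exprn_ge0 // divr_ge0 // ltW.
  by rewrite exprn_ege1 // ler_pdivlMr // mul1r; lra.
have k0 : (0 < k)%N.
  by case: k hk => // ; rewrite double0 expr0; lra.
(* Without repetitions, intervals shorter than some [d0] contain at most one
   point of [S]. *)
pose S := undup (cuts N%:R alpha Dn k.*2).
have [d0 d00 Hd0] := cnt_le1 (undup_uniq (cuts N%:R alpha Dn k.*2)).
pose K0 : R := (size S).+1%:R / (4 * d0).
have K00 : 0 < K0 by rewrite divr_gt0 // mulr_gt0.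
(* The losses add up to at most [dl * (2 * K0 + 1)], which is made equal to 1/2. *)
pose dl : R := 1 / (2 * (2 * K0 + 1)).
have dl0 : 0 < dl by rewrite divr_gt0 //; lra.
have [eta eta0 Heta] := uniform_hits dl0 albe H.
pose c := eta / Dd; have c0 : 0 < c by rewrite divr_gt0.
exists (c / 2); first by rewrite divr_gt0.
move=> m0 ell ell0 sup mono base.
have th n : 0 <= (1/2 : R) ^+ n by rewrite exprn_ge0 // divr_ge0.
have claim n : forall phi a b M, mobius phi -> alpha <= a -> a < b -> b <= be ->
   (forall y, a < y -> y < b -> iter M T (phi y) = y) -> (m0 <= M + n * k.*2)%N ->
   c * ((phi b - phi a) * (1 - dl * (2 * K0 * (1 - (1/2) ^+ n)) - dl * (1/2) ^+ n / (b - a))) <=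
     ell (phi a) (phi b).
  elim: n => [|n IH] phi a b M mphi aa ab bb HM hm.
    rewrite expr0 subrr !mulr0 subr0 mulr1.
    have aa0 : 0 < a by apply: lt_le_trans aa.
    have pab : 0 < phi b - phi a by rewrite subr_gt0; apply: mobius_mono.
    have ba : 0 < b - a by rewrite subr_gt0.
    have [big|small] := lerP dl (b - a); last first.
      apply: le_trans (ell0 _ _); rewrite mulr_ge0_le0 ?(ltW c0) // mulr_ge0_le0 ?(ltW pab) //.
      by rewrite subr_le0 ler_pdivlMr // mul1r ltW.
    have [s [t [j [as_ tb st Hj]]]] := Heta a b aa bb big.
    have st' : s < t by rewrite -subr_gt0; apply: lt_le_trans st.
    have s0 : 0 < s by apply: lt_le_trans as_.
    have pst : phi s < phi t by apply: mobius_mono.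
    have pas : phi a <= phi s.
      by move: as_; rewrite le_eqVlt => /predU1P[->//|h]; apply/ltW/mobius_mono.
    have ptb : phi t <= phi b.
      by move: tb; rewrite le_eqVlt => /predU1P[->//|h]; apply/ltW/mobius_mono => //; apply:
        lt_trans st'.
    apply: le_trans (mono _ _ _ _ pas pst ptb).
    apply: (@le_trans _ _ (phi t - phi s)); last first.
      apply: (base _ _ (M + j)%N _ pst).
        by move: hm; rewrite mul0n addn0 => /leq_trans; apply; apply: leq_addr.
      move=> z z1 z2; have [y [y1 y2 <-]] := mobius_surj mphi s0 st' z1 z2.
      by rewrite addnC iterD HM; [apply: Hj | apply: le_lt_trans y1 | apply: lt_le_trans y2 _].
    have := mobius_dist mphi a0 (ltW albe) aa (ltW ab) bb (le_trans aa as_) (ltW st') (le_trans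
      tb bb).
    rewrite -/Dd => dist.
    have k1 : (phi b - phi a) * eta <= Dd * (phi t - phi s).
      apply: (@le_trans _ _ ((phi b - phi a) * (t - s))); first by rewrite ler_wpM2l ?(ltW pab).
      apply: le_trans dist _; rewrite ler_wpM2l ?(ltW Dd0) // ler_piMr //.
        by rewrite subr_ge0 ltW.
      by move: aa bb; rewrite /be; clear -a0; lra.
    apply: (@le_trans _ _ (c * (phi b - phi a))).
      rewrite ler_wpM2l ?(ltW c0) // ler_piMr ?(ltW pab) //.
      by rewrite gerBl divr_ge0 ?(ltW dl0) ?(ltW ba).
    by rewrite /c mulrAC ler_pdivrMr // mulrC [X in _ <= X]mulrC.
  have aa0 : 0 < a by apply: lt_le_trans aa.
  have pab : 0 < phi b - phi a by rewrite subr_gt0; apply: mobius_mono.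
  have ba : 0 < b - a by rewrite subr_gt0.
  pose P := 1 - dl * (2 * K0 * (1 - (1/2) ^+ n)).
  pose Q := dl * (1/2) ^+ n * (phi b - phi a) / (4 * (b - a)).
  have Q0 : 0 <= Q by apply: divr_ge0; [apply: mulr_ge0; [apply: mulr_ge0 => //; exact:
    ltW|exact: ltW] | apply: mulr_ge0 => //; exact: ltW].
  have nice x y : a <= x -> x < y -> y <= b -> (forall p, p \in S -> x < p -> p < y -> False) ->
     c * ((phi y - phi x) * P - Q) <= ell (phi x) (phi y).
    move=> ax xy yb av.
    have av' : avoids (cuts N%:R alpha Dn k.*2) x y by move=> p pc; apply: av; rewrite mem_undup.
    have [psi [a' [b' [[mpsi A1 A2 A3] [B1 B2 B3 B4]]]]] :=
      cut_free_inverse a0 N2 ND (le_trans aa ax) xy (le_trans yb bb) av'.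
    have a'0 : 0 < a' by apply: lt_le_trans A1.
    have := IH (phi \o psi) a' b' (M + k.*2)%N (mobius_comp mphi mpsi) A1 A2 A3.
    rewrite /= B1 B2 => IH'.
    have ab' : 0 < b' - a' by rewrite subr_gt0.
    have pxy : 0 < phi y - phi x by rewrite subr_gt0; apply: mobius_mono => //; apply:
      lt_le_trans ax.
    have xy0 : 0 < y - x by rewrite subr_gt0.
    apply: le_trans (IH' _ _); last 2 first.
    - move=> z z1 z2; rewrite addnC iterD.
      have p1 : x < psi z by rewrite -B1; apply: mobius_mono.
      have p2 : psi z < y by rewrite -B2; apply: mobius_mono => //; apply: lt_trans z1.
      by rewrite HM; [apply: B3 | apply: le_lt_trans p1 | apply: lt_le_trans p2 _].
    - by rewrite -addnA -mulSn.
    rewrite -/P ler_wpM2l ?(ltW c0) // [X in _ <= X]mulrBr lerD2l lerN2.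
    have dist := mobius_dist mphi a0 (ltW albe) (le_trans aa ax) (ltW xy) (le_trans yb bb) aa
      (ltW ab) bb.
    rewrite -/Dd in dist.
    have k1 : 4 * Dd * (y - x) <= b' - a'.
      by apply: le_trans B4; rewrite ler_wpM2r // ltW.
    rewrite /Q mulrA ler_pdivrMr // [X in _ <= X]mulrAC ler_pdivlMr ?mulr_gt0 //.
    have -> : (phi y - phi x) * (dl * (1 / 2) ^+ n) * (4 * (b - a)) =
       (dl * (1 / 2) ^+ n) * (4 * ((phi y - phi x) * (b - a))) by ring.
    have -> : dl * (1 / 2) ^+ n * (phi b - phi a) * (b' - a') =
        (dl * (1 / 2) ^+ n) * ((phi b - phi a) * (b' - a')) by ring.
    have E0 : 0 <= dl * (1 / 2) ^+ n by rewrite mulr_ge0 ?th // ltW.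
    apply: ler_wpM2l E0 _ _ _.
    have h1 : (phi b - phi a) * (4 * Dd * (y - x)) <= (phi b - phi a) * (b' - a').
      by rewrite ler_wpM2l ?(ltW pab).
    apply: le_trans h1.
    have -> : (phi b - phi a) * (4 * Dd * (y - x)) = 4 * (Dd * ((phi b - phi a) * (y - x))) by
      ring.
    by apply: ler_wpM2l.
  have cQ0 : 0 <= c * Q by rewrite mulr_ge0 // ltW.
  have := split_content aa0 ab mphi cQ0 sup nice.
  apply: le_trans; rewrite ler_wpM2l ?(ltW c0) //.
  have -> : (phi b - phi a) * (1 - dl * (2 * K0 * (1 - (1 / 2) ^+ n.+1)) - dl * (1 / 2) ^+ n.+1 /
    (b - a)) =
     (phi b - phi a) * P - (phi b - phi a) * dl * (1/2) ^+ n * (K0 + 1 / (2 * (b - a))).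
    by rewrite /P exprS; field; rewrite lt0r_neq0.
  rewrite lerD2l lerN2.
  have -> : (cnt S a b).+1%:R * Q = (phi b - phi a) * dl * (1/2) ^+ n * ((cnt S a b).+1%:R / (4 *
    (b - a))).
    by rewrite /Q; field; rewrite lt0r_neq0.
  have E0 : 0 <= (phi b - phi a) * dl * (1 / 2) ^+ n.
    by apply: mulr_ge0 (th n); apply: mulr_ge0; exact: ltW.
  apply: ler_wpM2l E0 _ _ _.
  have [le1|gt1] := lerP (b - a) d0.
    have c1 : (cnt S a b).+1%:R <= 2 :> R by rewrite ler_nat ltnS Hd0.
    apply: (@le_trans _ _ (2 / (4 * (b - a)))).
      by apply: ler_wpM2r c1; rewrite invr_ge0 mulr_ge0 // ltW.
    have -> : 2 / (4 * (b - a)) = 1 / (2 * (b - a)) by field; rewrite lt0r_neq0.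
    by rewrite lerDr ltW.
  apply: (@le_trans _ _ K0); last by rewrite lerDl divr_ge0 ?mulr_ge0 // ltW.
  rewrite /K0; apply: ler_pM => //.
  - by rewrite invr_ge0 mulr_ge0 // ltW.
  - by rewrite ler_nat ltnS count_size.
  - by rewrite lef_pV2 ?posrE ?mulr_gt0 // ler_wpM2l // ltW.
have := claim m0 id alpha be 0%N (@mobius_id R) (lexx _) albe (lexx _) (fun _ _ _ => erefl).
rewrite add0n leq_pmulr ?double_gt0 // => /(_ isT).
apply: le_trans.
have -> : be - alpha = 1 by rewrite /be; lra.
rewrite divr1 mul1r ler_wpM2l ?(ltW c0) //.
have h1 : (1/2 : R) ^+ m0 <= 1 by rewrite exprn_ile1 //; lra.
have h2 : dl * (2 * K0 + 1) = 1/2 by rewrite /dl; field; rewrite lt0r_neq0 //; lra.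
have h3 : dl * (2 * K0 * (1 - (1/2) ^+ m0)) <= dl * (2 * K0).
  have K2 : 0 < 2 * K0 by apply: mulr_gt0.
  by apply: ler_wpM2l (ltW dl0) _ _ _; rewrite ger_pMr // gerBl.
have h4 : dl * (1/2) ^+ m0 <= dl by rewrite ger_pMr.
move: h2 h3 h4; clear -a0; lra.
Qed.
End LowerBound.

(** * Measure of the points visiting infinitely often *)

Section Avoidance.
Context {R : realType}.
Implicit Types (N : nat) (alpha : R) (U : set R).

(** A union of open intervals mapped into [U] at or after time [n], rather
    than the full set of such points: it is open, hence measurable, without any
    discussion of the measurability of [T]. *)
Definition visits (T : R -> R) U (n : nat) : set R :=
  \bigcup_(p in [set p : R * R | exists2 k, (n <= k)%N &
       forall z, p.1 < z -> z < p.2 -> U (iter k T z)]) `]p.1, p.2[%classic.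

Lemma visits_measurable T U n : measurable (visits T U n).
Proof. by apply: open_measurable; apply: bigcup_open => p _; exact: interval_open. Qed.

Lemma visitsP T U n x : visits T U n x -> exists2 k, (n <= k)%N & U (iter k T x).
Proof.
by move=> [p [k nk H]]; rewrite /= in_itv => /andP[h1 h2]; exists k => //; exact: H.
Qed.

Let mu := @lebesgue_measure R.

(** The sets of visits after time [n] decrease with [n] and have measure
    at least [c], hence so does their intersection, whose points visit [U]
    infinitely often. *)
Lemma not_avoided N alpha U : 0 < alpha -> (alpha + 1) ^+ 2 <= N%:R ->
  (forall x y, alpha <= x -> x < y -> y <= alpha + 1 -> hits (Tmap N alpha) U x y) ->
  ~ eventually_avoided N alpha U.
Proof.
move=> a0 N2 H av; have [c c0 Hc] := lower_bound a0 N2 H.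
set T := Tmap N alpha in Hc.
pose V n := `]alpha, alpha + 1[%classic `&` visits T U n.
have mV n : measurable (V n) by apply: measurableI => //; exact: visits_measurable.
have mL u v n : measurable (`]u, v[%classic `&` visits T U n).
  by apply: measurableI => //; exact: visits_measurable.
have lem (A B : set R) : measurable A -> measurable B -> A `<=` B -> (mu A <= mu B)%E.
  by move=> mA mB AB; apply: le_measure; rewrite ?inE.
have fin u v n : mu (`]u, v[%classic `&` visits T U n) \is a fin_num.
  rewrite ge0_fin_numE ?measure_ge0 //.
  apply: (@le_lt_trans _ _ (mu `]u, v[%classic)).
    by apply: lem.
  by rewrite /mu lebesgue_measure_itv /=; case: ifP => _; rewrite ltry.
have big n : (c%:E <= mu (V n))%E.
  rewrite /V -(fineK (fin _ _ _)) lee_fin.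
  apply: (Hc n (fun u v => fine (mu (`]u, v[%classic `&` visits T U n)))).
  - by move=> u v; rewrite fine_ge0 ?measure_ge0.
  - move=> u v w uv vw; rewrite -lee_fin EFinD !fineK //.
    rewrite -measureU; [|exact: mL|exact: mL|]; last first.
      rewrite -subset0 => z [[/= + _] [+ _]]; rewrite !in_itv /= => /andP[_ zv] /andP[vz _].
      by have := lt_trans zv vz; rewrite ltxx.
    apply: lem; [by apply: measurableU; exact: mL|exact: mL|].
    move=> z [[]|[]] /=; rewrite !in_itv /= => /andP[h1 h2] h3; split=> //.
      by rewrite h1 (lt_trans h2).
    by rewrite h2 (lt_trans _ h1).
  - move=> u v s t us st tv; rewrite -lee_fin !fineK //.
    apply: lem; [exact: mL|exact: mL|move=> z [] /=]; rewrite !in_itv /= => /andP[h1 h2] h3.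
    by split=> //; rewrite (le_lt_trans us h1) (lt_le_trans h2 tv).
  - move=> s t k nk st Hk; rewrite -lee_fin fineK //.
    have -> : `]s, t[%classic `&` visits T U n = `]s, t[%classic.
      by apply: setIidl => z hz; exists (s, t) => //; exists k.
    by rewrite /mu lebesgue_measure_itv /= lte_fin st EFinD.
have noninc : nonincreasing_seq V.
  apply/nonincreasing_seqP => n; rewrite subsetEset => z [h1 [p [k nk Hk] hz]]; split=> //.
  by exists p => //; exists k => //; exact: ltnW.
have mI : measurable (\bigcap_n V n) by exact: bigcap_measurable.
have cv := nonincreasing_cvg_mu (mu := mu) (F := V) _ mV mI noninc.
have /cv{}cv : (mu (V 0%N) < +oo)%E by rewrite -ge0_fin_numE ?measure_ge0 //; exact: fin.
have : (c%:E <= mu (\bigcap_n V n))%E.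
  have -> : mu (\bigcap_n V n) = limn (mu \o V) by apply/esym/cvg_lim.
  apply: lime_ge; first by apply/cvg_ex; exists (mu (\bigcap_n V n)).
  by apply: nearW => n; exact: big.
suff -> : mu (\bigcap_n V n) = 0%E by rewrite lee_fin leNgt c0.
apply/negligibleP => //; apply: negligibleS av => x hx /= hav.
have [] := hav.
  have [/= + _] := hx 0%N I; rewrite in_itv /= => /andP[h1 h2].
  by rewrite /Ialpha /= in_itv /= !ltW.
move=> n0 Hn0; have [_ /visitsP[k nk Uk]] := hx n0 I.
exact: (Hn0 k nk).
Qed.

(** A bad interval would make [[alpha, alpha + 1]] bad, although
    iterate 0 maps [U] into itself. *)
Lemma hits_everywhere N alpha (m : nat) (d : int) a b :
  (2 <= N)%N -> 0 < alpha -> alpha <= Num.sqrt N%:R - 1 ->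
  m = 2%N \/ m = 3%N -> cylinder_range N alpha d m ->
  fixpt N (d - 1) <= Tmap N alpha alpha \/
    Tmap N alpha (alpha + 1) <= fixpt N (d - m%:Z + 1) ->
  a < b -> `]a, b[ `<=` Ialpha alpha ->
  forall x y, alpha <= x -> x < y -> y <= alpha + 1 -> hits (Tmap N alpha) `]a, b[ x y.
Proof.
move=> N2 a0 aN m23 [dig1 dig2] hT ab Uab x y ax xy yb.
apply: contrapT => badxy.
have dm1 : 1 <= d - m%:Z.
  by have [_ _] := Tmap_beta dig2; apply: last_digit_ge1.
have bI : bad (Tmap N alpha) `]a, b[ alpha (alpha + 1).
  case: m23 => mE; subst m.
    have e2 : 2 <= d - 1 by lra.
    have i1 : digit N alpha alpha = d - 1 + 1 by rewrite dig1; ring.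
    have i2 : digit N alpha (alpha + 1) = d - 1 - 1 by rewrite dig2; ring.
    rewrite (_ : d - 2%:Z + 1 = d - 1) in hT; last by ring.
    case: hT => hT; first exact: (three_digits_left N2 a0 e2 i1 i2 hT ax xy yb badxy).
    exact: (three_digits_right N2 a0 e2 i1 i2 hT ax xy yb badxy).
  rewrite (_ : d - 3%:Z + 1 = d - 2) in hT; last by ring.
  case: hT => hT.
    have e3 : 3 <= d - 1 by lra.
    have i1 : digit N alpha alpha = d - 1 + 1 by rewrite dig1; ring.
    have i2 : digit N alpha (alpha + 1) = d - 1 - 2 by rewrite dig2; ring.
    exact: (four_digits_left N2 a0 e3 i1 i2 hT ax xy yb badxy).
  have e2 : 2 <= d - 2 by lra.
  have i1 : digit N alpha alpha = d - 2 + 2 by rewrite dig1; ring.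
  have i2 : digit N alpha (alpha + 1) = d - 2 - 1 by rewrite dig2; ring.
  exact: (four_digits_right N2 a0 e2 i1 i2 hT ax xy yb badxy).
have inI z : a < z -> z < b -> alpha <= z <= alpha + 1.
  by move=> az zb; have := Uab z; rewrite /Ialpha /= !in_itv /= az zb => /(_ isT).
apply: bI; exists a, b, 0%N; split=> //.
- rewrite leNgt; apply/negP => aal.
  have [k|k] := lerP b alpha.
    by have := inI ((a + b) / 2) ltac:(lra) ltac:(lra); lra.
  by have := inI ((a + alpha) / 2) ltac:(lra) ltac:(lra); lra.
- rewrite leNgt; apply/negP => bal.
  have [k|k] := lerP a (alpha + 1).
    by have := inI ((alpha + 1 + b) / 2) ltac:(lra) ltac:(lra); lra.
  by have := inI ((a + b) / 2) ltac:(lra) ltac:(lra); lra.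
- by move=> z h1 h2; rewrite /= in_itv /= h1.
Qed.

End Avoidance.

Theorem theorem6 (R : realType) (N : nat) (alpha : R) (m : nat) (d : int)
    (N_ge2 : (2 <= N)%N)
    (alpha_gt0 : 0 < alpha)
    (alpha_le : alpha <= Num.sqrt N%:R - 1)
    (m23 : m = 2%N \/ m = 3%N)
    (cyls : cylinder_range N alpha d m)
    (hT : fixpt N (d - 1) <= Tmap N alpha alpha \/
          Tmap N alpha (alpha + 1) <= fixpt N (d - m%:Z + 1)) :
  gapless N alpha.
Proof.
move=> [U [[[a [b [ab ->]]] [UI av]] _]].
have N2 : (alpha + 1) ^+ 2 <= N%:R.
  by rewrite -[leRHS]sqr_sqrtr // lerXn2r ?nnegrE ?sqrtr_ge0 //; lra.
apply: (not_avoided alpha_gt0 N2 _ av).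
exact: (hits_everywhere N_ge2 alpha_gt0 alpha_le m23 cyls hT ab UI).
Qed.
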